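(* Let $\mu$ be a critical offspring distribution such that $n\mapsto\mu(n)$ is $(-2)$-varying, and let $\theta$ have finite moment of order $\delta$ for all $\delta>0$. Then a $\mathcal T_n$-walk with $\theta$-jumps in $\mathbb Z^d$ is recurrent, whatever the dimension $d$ is: $$\frac{R^\theta(\mathcal T_n)}{n}\longrightarrow0\quad\text{in probability as }n\to+\infty.$$
   Context: $\mu$ is a probability distribution on $\mathbb N=\{0,1,2,\dots\}$; critical means $\sum_k k\mu(k)=1$ and $\mu\neq\delta_1$. A function $f$ is $\beta$-varying (regularly varying with index $\beta$ at $+\infty$) when $x\mapsto x^{-\beta}f(x)$ is slowly varying at $+\infty$; thus the assumption is that $\mu(n)=n^{-2}\ell_0(n)$ for large $n$ with $\ell_0$ slowly varying. $\theta$ is a centered probability distribution on $\mathbb Z^d$ with invertible covariance matrix. $\mathcal T$ is a $\mu$-Bienaymé (Galton–Watson) tree, and $\mathcal T_n$ is $\mathcal T$ conditioned to have $n+1$ vertices ($n$ ranges over the integers for which this event has positive probability). A $\mathcal T_n$-walk with $\theta$-jumps is $(W(u))_{u\in\mathcal T_n}$ with $W(\text{root})=0$ and, given the tree, i.i.d. increments $W(u)-W(v)$ with law $\theta$ over the edges from parent $v$ to child $u$. Its range is $R^\theta(\mathcal T_n)=\#\{W(u):u\in\mathcal T_n\}$. *)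

(* Defs.v *)
From HB Require Import structures.
From mathcomp Require Import all_boot all_order all_algebra.
From mathcomp Require Import all_classical all_reals all_analysis.

Set Implicit Arguments.
Unset Strict Implicit.
Unset Printing Implicit Defensive.

Import Order.TTheory GRing.Theory Num.Theory.
Import numFieldNormedType.Exports.

Local Open Scope classical_set_scope.
Local Open Scope ring_scope.

Inductive tree := Node of seq tree.

(* Ulam-Harris labels: the root is [::], and the i-th child (from 0) of u is
   rcons u i. *)
Fixpoint vertices (t : tree) : seq (seq nat) :=
  let: Node ts := t in
  [::] :: flatten [seq [seq p.1 :: u | u <- p.2]
                  | p <- zip (iota 0 (size ts)) (map vertices ts)].

Fixpoint offspring_numbers (t : tree) : seq nat :=
  let: Node ts := t in size ts :: flatten (map offspring_numbers ts).

Fixpoint tree_encode (t : tree) : GenTree.tree void :=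
  let: Node ts := t in GenTree.Node 0 (map tree_encode ts).

Fixpoint tree_decode (g : GenTree.tree void) : tree :=
  if g is GenTree.Node _ gs then Node (map tree_decode gs) else Node [::].

Lemma tree_encodeK : cancel tree_encode tree_decode.
Proof.
rewrite /cancel; fix IH 1; case=> ts /=; congr Node.
by elim: ts => //= t ts ->; rewrite IH.
Qed.

HB.instance Definition _ := Countable.copy tree (can_type tree_encodeK).
HB.instance Definition _ := isPointed.Build tree (Node [::]).
HB.instance Definition _ := @isMeasurable.Build default_measure_display
  tree discrete_measurable discrete_measurable0
  discrete_measurableC discrete_measurableU.

Definition lattice (d : nat) : Type := 'rV[int]_d.

HB.instance Definition _ d := GRing.Zmodule.on (lattice d).
HB.instance Definition _ d := Countable.on (lattice d).
HB.instance Definition _ d := isPointed.Build (lattice d) (0 : 'rV[int]_d).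
HB.instance Definition _ d := @isMeasurable.Build default_measure_display
  (lattice d) discrete_measurable discrete_measurable0
  discrete_measurableC discrete_measurableU.

Definition coordinate (R : realType) d (i : 'I_d) (x : lattice d) : R :=
  ((x : 'rV[int]_d) ord0 i)%:~R.

Definition euclidean_norm (R : realType) d (x : lattice d) : R :=
  Num.sqrt (\sum_(i < d) coordinate R i x ^+ 2).

Definition centered (R : realType) d (theta : probability (lattice d) R) :=
  forall i : 'I_d, ('E_theta[coordinate R i] = 0)%E.

Definition covariance_matrix (R : realType) d
    (theta : probability (lattice d) R) : 'M[R]_d :=
  \matrix_(i < d, j < d)
    fine (covariance theta (coordinate R i) (coordinate R j)).

Definition finite_moments (R : realType) d
    (theta : probability (lattice d) R) :=
  forall delta : R, 0 < delta ->
    ('E_theta[fun x => (euclidean_norm R x `^ delta)%R] < +oo)%E.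

Definition slowly_varying (R : realType) (l : R -> R) :=
  (exists a : R, measurable_fun `[a, +oo[ l /\ forall x, a <= x -> 0 < l x) /\
  forall c : R, 0 < c -> l (c * x) / l x @[x --> +oo] --> (1 : R).

Definition regularly_varying (R : realType) (beta : R) (f : R -> R) :=
  slowly_varying (fun x => x `^ (- beta) * f x).

Definition regularly_varying_seq (R : realType) (beta : R) (u : nat -> R) :=
  exists2 f : R -> R, regularly_varying beta f &
    \forall n \near \oo, u n = f n%:R.

Definition pmass (R : realType) (mu : probability nat R) (k : nat) : R :=
  fine (mu [set k]).

Definition critical (R : realType) (mu : probability nat R) :=
  ('E_mu[fun k => k%:R] = 1)%E /\ (mu : set nat -> \bar R) <> \d_1%N.

Definition bienayme_law (R : realType) (mu : probability nat R) (t : tree) : R :=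
  \prod_(k <- offspring_numbers t) pmass mu k.

Definition has_size (n : nat) : set tree := [set t | size (vertices t) = n.+1].

Definition bienayme_size (R : realType) (mu : probability nat R) (n : nat) :=
  (\esum_(t in has_size n) (bienayme_law mu t)%:E)%E.

Definition conditioned_law (R : realType) (mu : probability nat R)
    (n : nat) (t : tree) : R :=
  if t \in has_size n then bienayme_law mu t / fine (bienayme_size mu n) else 0.

Definition is_conditioned_bienayme (R : realType) (mu : probability nat R)
    (n : nat) disp (Omega : measurableType disp) (P : probability Omega R)
    (T : {RV P >-> tree}) :=
  forall t, P (T @^-1` [set t]) = (conditioned_law mu n t)%:E.

(* W w u is meaningful only when u is a vertex of T w; its other values are
   unconstrained. In walk_increments, x (rcons v i) is the prescribed jump along
   the edge from v to rcons v i: given T = t, the jumps are iid of law theta. *)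
Record is_tree_walk (R : realType) d (theta : probability (lattice d) R)
    disp (Omega : measurableType disp) (P : probability Omega R)
    (T : {RV P >-> tree}) (W : Omega -> seq nat -> lattice d) : Prop := {
  walk_measurable : forall t u, u \in vertices t ->
    measurable_fun (T @^-1` [set t]) (W ^~ u);
  walk_root : forall w, W w [::] = 0;
  walk_increments : forall (t : tree) (x : seq nat -> lattice d),
    P (T @^-1` [set t] `&`
       [set w | forall v i, rcons v i \in vertices t ->
          W w (rcons v i) - W w v = x (rcons v i)]) =
    (P (T @^-1` [set t]) *
     \prod_(u <- vertices t | u != [::]) theta [set x u])%E }.

Definition walk_range (t : tree) d (W : seq nat -> lattice d) : nat :=
  size (undup [seq W u | u <- vertices t]).

(* Main.v *)
Require Import Defs.
From HB Require Import structures.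
From mathcomp Require Import all_boot all_order all_algebra.
From mathcomp Require Import all_classical all_reals all_analysis.
From mathcomp Require Import measurable_realfun.
From mathcomp Require Import zify ring lra.

Set Implicit Arguments.
Unset Strict Implicit.
Unset Printing Implicit Defensive.

Import Order.TTheory GRing.Theory Num.Theory.
Import numFieldNormedType.Exports.

Local Open Scope classical_set_scope.
Local Open Scope ring_scope.

(** The walk stays in a ball so small that it has few sites to visit. Write
    [m k] for the offspring probabilities and [r] for the integer [K]-th root
    of [n], where [K = 3 d + 2]. Conditionally on having [n + 1] vertices, the
    tree has height below [r ^ 2] and all the jumps have coordinates of absolute
    value at most [r], with probability tending to one. On this event all the
    values of the walk lie in a box with at most [(2 r ^ 3 + 1) ^ d] points,
    which is negligible with respect to [n >= r ^ (3 d + 2)].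

    The jumps are controlled by Markov's inequality, since [theta] has a finite
    moment of order [K + 1] ([box_mass_ge]). The height is where the index [-2]
    matters. The quantity [eta = 1 - \sum_(k <= n) k * m k] is the mean carried
    by the offspring numbers larger than [n]; regular variation makes it larger
    than a constant times [n ^ (- 1 / K)] ([mean_gap_lower]). A tree with
    [n + 1] vertices has no offspring number above [n], so it is a tree of the
    subcritical branching process of mean [1 - eta]; the first moment method
    bounds the weight of those of height at least [r ^ 2] by
    [(1 - eta) ^ (r ^ 2) <= exp (- b * r / 2)] ([sum_bounded_trees_high]).

    This beats the conditioning, because the total weight of the trees with
    [n + 1] vertices decreases at most polynomially ([trees_of_size_lower]).
    Indeed, such a tree consists of a root with [k] children and of a forest of
    [k] trees with [n] vertices; forests correspond to words of [n] letters all
    of whose nonempty suffixes [s] satisfy [sumn s < size s], and by the cycle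
    lemma every word of sum at most [n - k0], [k0 > 0], has a rotation of this
    type. Since [m k] is polynomially small at worst ([pmass_lower_cube]), it
    remains to bound below the probability that [n] independent offspring
    numbers have a sum at most [n - k0], and a truncation at [n], which makes
    the mean drop by [eta], does this ([sum_words_excess_ge]).

    The lower bounds on [m] rest on Karamata's uniform convergence theorem for
    slowly varying functions ([uniform_convergence]). *)

(** * Sums over words *)

Fixpoint words (A : Type) (L : seq A) (n : nat) : seq (seq A) :=
  if n is n'.+1 then [seq x :: s | x <- L, s <- words L n'] else [:: [::]].

Lemma sum_wordsS (R : nmodType) (A : Type) (L : seq A) n (F : seq A -> R) :
  \sum_(s <- words L n.+1) F s =
  \sum_(x <- L) \sum_(s <- words L n) F (x :: s).
Proof. by rewrite /= big_allpairs_dep. Qed.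

Lemma mem_words (A : eqType) (L : seq A) n s :
  (s \in words L n) = (size s == n) && all [in L] s.
Proof.
elim: n s => [|n IH] [|x s] //=; first by apply/allpairsPdep => -[? [? []]].
apply/allpairsPdep/idP => [[y [s' [yL]]]|].
  by rewrite IH => /andP[/eqP <- ?] [-> ->]; rewrite eqSS eqxx yL.
rewrite eqSS => /and3P[sn xL sL]; exists x, s; split => //.
by rewrite IH sn.
Qed.

Lemma uniq_words (A : eqType) (L : seq A) n : uniq L -> uniq (words L n).
Proof.
move=> uL; elim: n => //= n IH; apply: allpairs_uniq_dep => // [[x s]] [y s'].
by move=> _ _ /= [-> ->].
Qed.

Lemma sum_words_prod (R : comPzSemiRingType) (A : Type) (L : seq A)
    (p : A -> R) n :
  \sum_(s <- words L n) \prod_(x <- s) p x = (\sum_(x <- L) p x) ^+ n.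
Proof.
elim: n => [|n IH]; first by rewrite big_seq1 big_nil expr0.
rewrite sum_wordsS exprS -IH mulr_suml; apply: eq_bigr => x _.
by rewrite mulr_sumr; apply: eq_bigr => s _; rewrite big_cons.
Qed.

(** By linearity of the expectation: each of the [n] positions contributes
    the same amount, the other letters being summed out. *)
Lemma sum_words_prod_sum (R : comPzSemiRingType) (A : Type) (L : seq A)
    (p b : A -> R) n :
  \sum_(s <- words L n) \prod_(x <- s) p x * \sum_(x <- s) b x =
  n%:R * (\sum_(x <- L) p x * b x) * (\sum_(x <- L) p x) ^+ n.-1.
Proof.
elim: n => [|n IH]; first by rewrite big_seq1 !big_nil !mul0r mulr0.
rewrite sum_wordsS.
pose G := \sum_(x <- L) p x; pose B := \sum_(x <- L) p x * b x.
transitivity (\sum_(x <- L) (p x * b x * G ^+ n +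
    p x * (n%:R * B * G ^+ n.-1))).
  apply: eq_bigr => x _; rewrite -IH -sum_words_prod !mulr_sumr -big_split /=.
  by apply: eq_bigr => s _; rewrite !big_cons; ring.
rewrite big_split /= -!mulr_suml -/G -/B /=.
case: n {IH} => [|n]; first by rewrite expr0 !mul0r mulr0 addr0 mul1r mulr1.
by rewrite /= -[n.+2]addn1 natrD exprS; ring.
Qed.

Lemma sum_words_rcons (R : nmodType) (A : Type) (L : seq A) n (F : seq A -> R) :
  \sum_(s <- words L n.+1) F s =
  \sum_(s <- words L n) \sum_(x <- L) F (rcons s x).
Proof.
elim: n F => [|n IH] F.
  by rewrite sum_wordsS /= big_seq1; apply: eq_bigr => x _; rewrite big_seq1.
rewrite sum_wordsS [RHS]sum_wordsS; apply: eq_bigr => x _.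
by rewrite IH.
Qed.

(** Invariance of the product weights under rotation, which the cycle lemma
    requires. *)
Lemma sum_words_rot (R : nmodType) (A : eqType) (L : seq A) n j
    (F : seq A -> R) : (j <= n)%N ->
  \sum_(s <- words L n) F (rot j s) = \sum_(s <- words L n) F s.
Proof.
have rot1 (G : seq A -> R) :
    \sum_(s <- words L n) G (rot 1 s) = \sum_(s <- words L n) G s.
  case: n => [|n]; first by rewrite !big_seq1.
  rewrite sum_wordsS sum_words_rcons exchange_big /=.
  by under eq_bigr do under eq_bigr do rewrite rot1_cons.
elim: j => [|j IH] jn; first by under eq_bigr do rewrite rot0.
rewrite -(IH (ltnW jn)) -(rot1 (F \o rot j)) big_seq [RHS]big_seq.
apply: eq_bigr => s; rewrite mem_words => /andP[/eqP ss _] /=.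
by rewrite rot_rot -rotS ?ss.
Qed.

(** * Trees *)

(** The generated induction principle gives no hypothesis on the subtrees, which
    are nested in a list. *)
Lemma tree_ind_seq (Q : tree -> Prop) :
  (forall ts, {in ts, forall t, Q t} -> Q (Node ts)) -> forall t, Q t.
Proof.
move=> H; fix IH 1; case=> ts; apply: H.
elim: ts => [|t ts IHts] u; first by move=> abs; exfalso; move: abs.
rewrite inE => /orP[/eqP ->|]; [exact: IH|exact: IHts].
Qed.

Fixpoint height (t : tree) : nat :=
  let: Node ts := t in foldr maxn 0%N [seq (height t).+1 | t <- ts].

Lemma height_Node_gt ts h : (h < height (Node ts))%N =
  has (fun t => h <= height t)%N ts.
Proof. by elim: ts => //= t ts <-; rewrite leq_max ltnS. Qed.

Lemma size_vertices t : size (vertices t) = size (offspring_numbers t).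
Proof.
elim/tree_ind_seq: t => ts IH /=; congr S.
elim: ts 0%N IH => //= t ts IHts i IH; rewrite !size_cat size_map IHts.
  by rewrite IH ?mem_head.
by move=> u uts; apply: IH; rewrite inE uts orbT.
Qed.

(** The non-root part of [vertices (Node ts)], with the labels of the children
    shifted by [i] so that it can be handled by induction on [ts]. *)
Definition child_vertices i (ts : seq tree) :=
  flatten [seq [seq p.1 :: u | u <- p.2]
          | p <- zip (iota i (size ts)) (map vertices ts)].

Lemma mem_child_vertices ts i j u : (j :: u \in child_vertices i ts) =
  (i <= j < i + size ts)%N && (u \in vertices (nth (Node [::]) ts (j - i))).
Proof.
elim: ts i => [|t ts IH] i; first by rewrite addn0 leqNgt andNb.
rewrite /child_vertices /= mem_cat [X in _ || X]IH addSnnS.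
have [-> | ij] := eqVneq j i.
  rewrite subnn ltnn /= orbF leqnn addnS ltnS leq_addr /=.
  by rewrite mem_map // => ? ? [].
rewrite [_ \in map _ _](_ : _ = false); last first.
  by apply/negbTE/mapP => -[v _ [/eqP]]; rewrite (negPf ij).
have [ltij|] := ltnP i j; last first.
  by rewrite leq_eqVlt (negPf ij) /= => ji; rewrite leqNgt ji.
by rewrite -(subnSK ltij) (ltnW ltij).
Qed.

Lemma child_verticesP ts i v : v \in child_vertices i ts ->
  exists j u, v = j :: u.
Proof. by move=> /flatten_mapP[p _ /mapP[u _ ->]]; exists p.1, u. Qed.

Lemma mem_vertices_cons ts i u : (i :: u \in vertices (Node ts)) =
  (i < size ts)%N && (u \in vertices (nth (Node [::]) ts i)).
Proof.
by rewrite [LHS]inE /= -/(child_vertices 0 ts) mem_child_vertices subn0.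
Qed.

Lemma uniq_vertices t : uniq (vertices t).
Proof.
elim/tree_ind_seq: t => ts IH /=; rewrite -/(child_vertices 0 ts).
apply/andP; split; first by apply/negP => /child_verticesP[? [? ]].
elim: ts 0%N IH => // t ts IHts i IH.
rewrite /child_vertices /= cat_uniq -/(child_vertices i.+1 ts) IHts; last first.
  by move=> u uts; apply: IH; rewrite inE uts orbT.
rewrite map_inj_uniq ?IH ?mem_head //=; last by move=> ? ? [].
rewrite andbT; apply/hasPn => _ /[dup] /child_verticesP[j [u ->]].
rewrite mem_child_vertices => /andP[/andP[ij _] _].
by apply/mapP => -[v _ [ji]]; rewrite ji ltnn in ij.
Qed.

Lemma vertices_prefix t v i : rcons v i \in vertices t -> v \in vertices t.
Proof.
elim: v t i => [|j v IH] [ts] i; first by rewrite inE.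
by rewrite rcons_cons !mem_vertices_cons => /andP[-> /IH].
Qed.

Lemma size_vertex t u : u \in vertices t -> (size u <= height t)%N.
Proof.
elim: u t => [//|j u IH] [ts]; rewrite mem_vertices_cons => /andP[jts /IH uh].
by rewrite height_Node_gt; apply/hasP; exists (nth (Node [::]) ts j);
  rewrite ?mem_nth.
Qed.

Lemma offspring_numbers_Node ts : offspring_numbers (Node ts) =
  size ts :: flatten (map offspring_numbers ts).
Proof. by []. Qed.

Lemma size_offspring_child t ts : t \in ts ->
  (size (offspring_numbers t) <= size (flatten (map offspring_numbers ts)))%N.
Proof.
elim: ts => //= t' ts IH; rewrite inE size_cat => /orP[/eqP ->|/IH].
  exact: leq_addr.
by move/leq_trans; apply; exact: leq_addl.
Qed.

Lemma size_offspring_Node ts : size (offspring_numbers (Node ts)) =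
  (size (flatten (map offspring_numbers ts))).+1.
Proof. by []. Qed.

Lemma offspring_number_lt t k :
  k \in offspring_numbers t -> (k < size (offspring_numbers t))%N.
Proof.
elim/tree_ind_seq: t k => ts IH k; rewrite size_offspring_Node ltnS.
rewrite offspring_numbers_Node in_cons => /orP[/eqP ->|].
  rewrite size_flatten sumnE !big_map -sum1_size.
  by apply: leq_sum => -[].
move=> /flatten_mapP[t tts /(IH _ tts)/ltnW kt].
by apply: leq_trans kt _; apply: size_offspring_child.
Qed.

Lemma height_lt t : (height t < size (offspring_numbers t))%N.
Proof.
elim/tree_ind_seq: t => ts IH; rewrite size_offspring_Node ltnS leqNgt.
rewrite height_Node_gt; apply/hasPn => t tts; rewrite -ltnNge.
by apply: leq_trans (IH t tts) _; apply: size_offspring_child.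
Qed.

(** An explicit enumeration makes the sums over trees finite, and its recursion
    is the branching property at the root. *)
Fixpoint bounded_trees (M h : nat) : seq tree :=
  if h is h'.+1 then
    [seq Node ts | k <- iota 0 M.+1, ts <- words (bounded_trees M h') k]
  else [::].

Lemma bounded_treesS M h : bounded_trees M h.+1 =
  [seq Node ts | k <- iota 0 M.+1, ts <- words (bounded_trees M h) k].
Proof. by []. Qed.

Lemma mem_bounded_trees M h t : (t \in bounded_trees M h) =
  (height t < h)%N && all (fun k => k <= M)%N (offspring_numbers t).
Proof.
elim: h t => [|h IH] [ts] //.
rewrite ltnS leqNgt height_Node_gt -all_predC.
apply/allpairsPdep/idP => [[k [ts' [+ + [->]]]]|].
  rewrite mem_iota add0n ltnS mem_words => /= kM /andP[/eqP sz /allP tsin] /=.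
  rewrite sz kM; apply/andP; split; apply/allP => t.
    by move=> /tsin /=; rewrite IH -ltnNge => /andP[].
  by move=> /flatten_mapP[u /tsin /=]; rewrite IH => /andP[_ /allP]; apply.
move=> /andP[/allP a /= /andP[kM /allP b]].
exists (size ts), ts; split=> //; first by rewrite (mem_iota 0 M.+1) add0n ltnS.
rewrite mem_words eqxx; apply/allP => t tts /=; rewrite IH ltnNge;
  move: (a t tts) => /= -> /=.
by apply/allP => k kt; apply: b; apply/flatten_mapP; exists t.
Qed.

Lemma uniq_bounded_trees M h : uniq (bounded_trees M h).
Proof.
elim: h => // h IH; apply: allpairs_uniq_dep; first exact: iota_uniq.
  by move=> k _; apply: uniq_words.
move=> [k ts] [k' ts'].
move=> /allpairsPdep[k1 [ts1 [_ + E1]]] /allpairsPdep[k2 [ts2 [_ + E2]]].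
rewrite !mem_words => /andP[/eqP sz1 _] /andP[/eqP sz2 _].
rewrite E1 E2 /= => -[tt]; subst.
by [].
Qed.

(** * The height of a tree with bounded offspring numbers *)

Section Weights.
Context {R : realFieldType} (m : nat -> R).

Definition tree_weight (t : tree) : R := \prod_(k <- offspring_numbers t) m k.

Lemma tree_weight_Node ts :
  tree_weight (Node ts) = m (size ts) * \prod_(t <- ts) tree_weight t.
Proof.
by rewrite /tree_weight offspring_numbers_Node big_cons big_flatten big_map.
Qed.

Lemma sum_bounded_treesS M h (F : tree -> R) :
  \sum_(t <- bounded_trees M h.+1) tree_weight t * F t =
  \sum_(0 <= k < M.+1) m k * \sum_(ts <- words (bounded_trees M h) k)
     \prod_(t <- ts) tree_weight t * F (Node ts).
Proof.
rewrite bounded_treesS big_allpairs_dep /index_iota subn0.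
apply: eq_bigr => k _; rewrite mulr_sumr big_seq [RHS]big_seq.
apply: eq_bigr => ts; rewrite mem_words => /andP[/eqP <- _].
by rewrite tree_weight_Node mulrA.
Qed.

Hypothesis m_ge0 : forall k, 0 <= m k.
Hypothesis m_le1 : forall n, \sum_(0 <= k < n) m k <= 1.

Lemma tree_weight_ge0 t : 0 <= tree_weight t.
Proof. by apply: prodr_ge0. Qed.

Lemma sum_bounded_trees_le1 M h :
  \sum_(t <- bounded_trees M h) tree_weight t <= 1.
Proof.
elim: h => [|h IH]; first by rewrite big_nil.
under eq_bigr do rewrite -[tree_weight _]mulr1.
rewrite sum_bounded_treesS; apply: le_trans (m_le1 M.+1).
apply: ler_sum => k _; under eq_bigr do rewrite mulr1.
rewrite sum_words_prod ler_piMr // exprn_ile1 //.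
by apply: sumr_ge0 => t _; apply: tree_weight_ge0.
Qed.

(** First moment bound: a tree has height greater than [h] when one of the
    subtrees of its root has height at least [h], so that the union bound over
    these subtrees costs, at each generation, the mean of [m] truncated at
    [M]. *)
Lemma sum_bounded_trees_high M H h :
  \sum_(t <- bounded_trees M H | (h <= height t)%N) tree_weight t <=
  (\sum_(0 <= k < M.+1) k%:R * m k) ^+ h.
Proof.
elim: h H => [|h IH] H; first by rewrite expr0 sum_bounded_trees_le1.
pose b t : R := (h <= height t)%N%:R.
case: H => [|H].
  rewrite big_nil exprn_ge0 //; apply: sumr_ge0 => k _.
  by rewrite mulr_ge0 ?ler0n.
rewrite big_mkcond /=.
under eq_bigr do rewrite -mulrb -mulr_natr.
rewrite sum_bounded_treesS exprS mulr_suml; apply: ler_sum => k _.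
rewrite mulrAC [_ * m k]mulrC ler_wpM2l //.
apply: (@le_trans _ _ (\sum_(ts <- words (bounded_trees M H) k)
    \prod_(t <- ts) tree_weight t * \sum_(t <- ts) b t)).
  apply: ler_sum => ts _; rewrite ler_wpM2l //.
    by apply: prodr_ge0 => t _; apply: tree_weight_ge0.
  rewrite height_Node_gt; elim: ts => [|t ts IHts]; first by rewrite big_nil.
  rewrite big_cons /= /b; case: (h <= height t)%N => /=.
    by rewrite lerDl sumr_ge0.
  by rewrite add0r.
rewrite sum_words_prod_sum -mulrA ler_wpM2l ?ler0n //.
rewrite -[leRHS]mulr1 ler_pM //.
- by apply: sumr_ge0 => t _; rewrite mulr_ge0 ?tree_weight_ge0 ?ler0n.
- by apply: exprn_ge0; apply: sumr_ge0 => t _; apply: tree_weight_ge0.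
- apply: le_trans (IH H); rewrite [leRHS]big_mkcond; apply: ler_sum => t _.
  by rewrite /b mulr_natr mulrb.
- rewrite exprn_ile1 ?sum_bounded_trees_le1 //.
  by apply: sumr_ge0 => t _; apply: tree_weight_ge0.
Qed.

End Weights.

(** * Decoding depth-first words *)

(** The word is read from right to left, keeping the forest decoded so far:
    a letter [x] takes the first [x] trees of that forest as the subtrees of a
    new vertex. *)
Fixpoint decode (s : seq nat) : seq tree :=
  if s is x :: s' then Node (take x (decode s')) :: drop x (decode s')
  else [::].

(** The excess is the number of trees of the forest; it is the final height,
    up to sign, of the Lukasiewicz path. *)
Definition excess (s : seq nat) : int := (size s)%:Z - (sumn s)%:Z.

(** Positivity of the excess of a suffix [x :: s'] means that the forest decoded
    from [s'] contains the [x] trees that the letter [x] takes. *)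
Fixpoint forest_word (s : seq nat) : bool :=
  if s is x :: s' then (0 < excess s) && forest_word s' else true.

Lemma excess_cons x s : excess (x :: s) = 1 - x%:Z + excess s.
Proof. by rewrite /excess /= ; lia. Qed.

Lemma excess_cat s1 s2 : excess (s1 ++ s2) = excess s1 + excess s2.
Proof. by rewrite /excess size_cat sumn_cat; lia. Qed.

Lemma decodeK s : forest_word s ->
  flatten (map offspring_numbers (decode s)) = s /\
  (size (decode s))%:Z = excess s.
Proof.
elim: s => //= x s IH /andP[ex /IH[flat sz]].
rewrite excess_cons in ex *.
have xs : (x <= size (decode s))%N by lia.
split; last by rewrite size_drop; lia.
by rewrite size_takel // -flatten_cat -map_cat cat_take_drop flat.
Qed.

Lemma forest_wordP s :
  reflect (forall i, (i < size s)%N -> 0 < excess (drop i s)) (forest_word s).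
Proof.
elim: s => [|x s IH]; first by apply: ReflectT.
apply: (iffP andP) => [[ex /IH H] [|i]//|H]; first exact: H.
by split; [exact: (H 0%N)|apply/IH => i; apply: (H i.+1)].
Qed.

(** Cycle lemma, existence part. Rotate at the first time at which the excess
    of the prefixes is maximal: the excess of a suffix of the rotated word is
    the difference between this maximum and an earlier value or, when the
    suffix goes around the word, at least the excess of the whole word. *)
Lemma forest_word_rot s : 0 < excess s ->
  exists2 j, (j < size s)%N & forest_word (rot j s).
Proof.
move=> s_gt0.
have s0 : (0 < size s)%N by case: s s_gt0.
pose g i := excess (take i s).
have [j js [gmax gfirst]] : exists2 j, (j < size s)%N &
    (forall i, (i < size s)%N -> g i <= g j) /\
    (forall i, (i < j)%N -> g i < g j).
  have : exists2 j, (j < size s)%N & forall i, (i < size s)%N -> g i <= g j.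
    pose o0 := Ordinal s0.
    case: (@Order.TotalTheory.arg_maxP _ _ _ o0 predT
      (fun i : 'I_(size s) => g i)) => // i _ H.
    by exists i => // k ks; apply: (H (Ordinal ks)).
  move=> [j js gj].
  have ex : exists j, (j < size s)%N && [forall i : 'I_(size s), g i <= g j].
    by exists j; rewrite js; apply/forallP => i; apply: gj.
  case: (ex_minnP ex) => k /andP[ks /forallP gk] mink; exists k => //.
  have gk' i : (i < size s)%N -> g i <= g k.
    by move=> Hi; apply: (gk (Ordinal Hi)).
  split => // i ik; rewrite ltNge; apply/negP => kgi.
  suff : (k <= i)%N by rewrite leqNgt ik.
  apply: mink; rewrite (ltn_trans ik ks) /=.
  by apply/forallP => l; apply: le_trans (gk l) kgi.
exists j => //; apply/forest_wordP => i; rewrite size_rot => lis.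
have exc_drop k r : excess (drop k r) = excess r - excess (take k r).
  by rewrite -{2}(cat_take_drop k r) excess_cat; lia.
rewrite /rot drop_cat size_drop; case: ltnP => [ij|ji].
  rewrite drop_drop excess_cat exc_drop -/(g _) -/(g j).
  by have := gmax (i + j)%N; lia.
set i' := (i - _)%N; have i'j : (i' < j)%N by rewrite /i'; lia.
rewrite exc_drop take_takel ?(ltnW i'j) // subr_gt0; exact: gfirst.
Qed.

(** * Lower bound on the weight of the trees of a given size *)

Lemma ler_sum_sub (R : numDomainType) (I : eqType) (l1 l2 : seq I)
    (P : pred I) (F : I -> R) :
  uniq l1 -> uniq l2 -> {in l1, forall i, i \in l2 /\ P i} ->
  (forall i, 0 <= F i) ->
  \sum_(i <- l1) F i <= \sum_(i <- l2 | P i) F i.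
Proof.
move=> u1 u2 sub F0.
rewrite [leRHS](bigID [in l1]) /= -[leLHS]addr0 lerD ?sumr_ge0 //.
rewrite -[leRHS]big_filter le_eqVlt; apply/orP; left; apply/eqP.
apply: perm_big; apply: uniq_perm; rewrite ?filter_uniq // => i.
rewrite mem_filter; apply/idP/idP => [i1|/andP[/andP[]]//].
by have [-> ->] := sub _ i1; rewrite i1.
Qed.

Section SizeLowerBound.
Context {R : realFieldType} (m : nat -> R) (n : nat).
Hypothesis m_ge0 : forall k, 0 <= m k.

Let L := iota 0 n.+1.

(** The cycle lemma and a union bound over the [n] rotations, which all have
    the same weight and the same excess. *)
Lemma sum_forest_words k0 : (0 < k0)%N ->
  \sum_(s <- words L n | k0%:Z <= excess s) \prod_(x <- s) m x <=
  n%:R * \sum_(s <- words L n | forest_word s && (k0%:Z <= excess s))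
     \prod_(x <- s) m x.
Proof.
move=> k0_gt0.
pose Q s := forest_word s && (k0%:Z <= excess s).
pose F s := if Q s then \prod_(x <- s) m x else 0.
have F0 s : 0 <= F s by rewrite /F; case: ifP => // _; apply: prodr_ge0.
rewrite [X in _ <= _ * X]big_mkcond /= -/F.
have -> : n%:R * \sum_(s <- words L n) F s =
    \sum_(s <- words L n) \sum_(0 <= j < n) F (rot j s).
  rewrite exchange_big /=.
  transitivity (\sum_(0 <= j < n) \sum_(s <- words L n) F s).
    by rewrite big_const_nat subn0 iter_addr_0 mulr_natl.
  by apply: eq_big_nat => j /andP[_ jn]; rewrite (sum_words_rot _ _ (ltnW jn)).
rewrite big_mkcond /= big_seq [leRHS]big_seq; apply: ler_sum => s.
rewrite mem_words => /andP[/eqP sn _]; case: ifP => [ks|_]; last first.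
  by apply: sumr_ge0.
have [|j js fj] := @forest_word_rot s; first by lia.
rewrite big_mkord (bigD1 (Ordinal (leq_trans js (eq_leq sn)))) //=.
have -> : F (rot j s) = \prod_(x <- s) m x.
  rewrite /F /Q fj (_ : excess (rot j s) = excess s) ?ks.
    by apply: perm_big; rewrite perm_rot.
  by rewrite /excess size_rot; congr (_ - _%:Z); apply: perm_sumn;
    rewrite perm_rot.
by rewrite lerDl sumr_ge0.
Qed.

(** A forest of [k] trees becomes a tree when a root with [k] children is
    added below it, at the cost of a factor [m k]. *)
Lemma sum_trees_of_size_ge k0 beta :
  (forall k, (k0 <= k <= n)%N -> beta <= m k) ->
  beta * \sum_(s <- words L n | forest_word s && (k0%:Z <= excess s))
     \prod_(x <- s) m x <=
  \sum_(t <- bounded_trees n n.+1 | size (offspring_numbers t) == n.+1)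
     tree_weight m t.
Proof.
move=> betam; rewrite -big_filter; set l := [seq s <- _ | _].
have lP s : s \in l -> [/\ size s = n, offspring_numbers (Node (decode s)) =
    size (decode s) :: s & (k0 <= size (decode s) <= n)%N].
  rewrite mem_filter mem_words => /andP[/andP[fs ks] /andP[/eqP sn _]].
  have [ds es] := decodeK fs; rewrite offspring_numbers_Node ds; split=> //.
  by move: ks; rewrite -es lez_nat => ->; move: es; rewrite /excess sn; lia.
apply: (@le_trans _ _
    (\sum_(t <- [seq Node (decode s) | s <- l]) tree_weight m t)).
  rewrite big_map mulr_sumr big_seq [leRHS]big_seq; apply: ler_sum => s sl.
  have [_ os ks] := lP s sl.
  rewrite /tree_weight os big_cons ler_wpM2r ?betam //.
  exact: prodr_ge0.
apply: ler_sum_sub.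
- rewrite map_inj_in_uniq ?filter_uniq ?uniq_words ?iota_uniq //.
  move=> s s' sl s'l ss'; have [_ os _] := lP s sl; have [_ os' _] := lP s' s'l.
  have := congr1 offspring_numbers ss'.
  by rewrite os os' => -[].
- exact: uniq_bounded_trees.
- move=> _ /mapP[s sl ->]; have [sn os /andP[_ ks]] := lP s sl.
  have sz : size (offspring_numbers (Node (decode s))) = n.+1.
    by rewrite os /= sn.
  rewrite sz eqxx; split => //.
  rewrite mem_bounded_trees -[X in (_ < X)%N]sz height_lt andTb.
  by apply/allP => k /offspring_number_lt; rewrite sz ltnS.
- by move=> t; apply: tree_weight_ge0.
Qed.

Hypothesis m_le1 : \sum_(0 <= k < n.+1) m k <= 1.

(** Moving the missing mass of [m] to the letter [0] gives a probability whose
    mean is below 1 by [eta], the first difference in the statement; a word of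
    [n] independent letters hence has excess at least [k0] with probability at
    least [eta - k0 / n], and the change of measure costs at most a factor
    [kappa ^+ n]. *)
Lemma sum_words_excess_ge (k0 : nat) (kappa : R) : (0 < n)%N -> 1 <= kappa ->
  m 0%N + (1 - \sum_(0 <= k < n.+1) m k) <= kappa * m 0%N ->
  1 - \sum_(0 <= k < n.+1) k%:R * m k - k0%:R / n%:R <=
  kappa ^+ n *
  \sum_(s <- words L n | k0%:Z <= excess s) \prod_(x <- s) m x.
Proof.
move=> n_gt0 kappa1 mkappa.
pose p x := if x == 0%N then m 0%N + (1 - \sum_(0 <= k < n.+1) m k) else m x.
have iotaE : index_iota 0 n.+1 = L by rewrite /index_iota subn0.
have Lcons : L = 0%N :: iota 1 n by [].
have p_ge0 x : 0 <= p x.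
  by rewrite /p; case: eqP => // _; rewrite addr_ge0 ?subr_ge0.
have p_le x : p x <= kappa * m x.
  by rewrite /p; case: eqP => [->//|_]; rewrite ler_peMl.
have sum_p (b : nat -> R) :
    \sum_(x <- L) p x * b x =
    \sum_(x <- L) m x * b x + (1 - \sum_(0 <= k < n.+1) m k) * b 0%N.
  set tail := 1 - _; rewrite Lcons !big_cons {1}/p eqxx -/tail mulrDl.
  rewrite (_ : \sum_(_ <- _) p _ * _ = \sum_(x <- iota 1 n) m x * b x);
    first by ring.
  rewrite big_seq [RHS]big_seq; apply: eq_bigr => -[|x]; last by [].
  by rewrite mem_iota.
have p1 : \sum_(x <- L) p x = 1.
  transitivity (\sum_(x <- L) p x * 1).
    by apply: eq_bigr => x _; rewrite mulr1.
  rewrite (sum_p (fun=> 1)) mulr1; under eq_bigr do rewrite mulr1.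
  by rewrite iotaE addrC subrK.
have mean : \sum_(x <- L) p x * x%:R = \sum_(0 <= k < n.+1) k%:R * m k.
  by rewrite (sum_p (fun x => x%:R)) mulr0 addr0 iotaE; apply: eq_bigr => k _;
    rewrite mulrC.
set eta := 1 - _.
pose P1 := \sum_(s <- words L n | k0%:Z <= excess s) \prod_(x <- s) p x.
have P1le : P1 <= kappa ^+ n *
    \sum_(s <- words L n | k0%:Z <= excess s) \prod_(x <- s) m x.
  rewrite mulr_sumr /P1 big_seq_cond [leRHS]big_seq_cond.
  apply: ler_sum => s /andP[]; rewrite mem_words => /andP[/eqP <- _] _.
  elim: s => [|x s IH]; first by rewrite !big_nil mulr1.
  rewrite !big_cons /= exprS mulrACA ler_pM //.
  by apply: prodr_ge0.
apply: le_trans P1le.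
have n0 : (0 : R) < n%:R by rewrite ltr0n.
rewrite -(ler_pM2r n0) mulrBl divfK ?gt_eqF //.
have cst (c : R) : \sum_(s <- words L n) \prod_(x <- s) p x * c = c.
  by rewrite -mulr_suml sum_words_prod p1 expr1n mul1r.
(* Both sides are the expectation of the excess under [p]; the excess is at most
   [k0] plus [n] times the indicator of the event. *)
have e1 : n%:R - (\sum_(0 <= k < n.+1) k%:R * m k) * n%:R =
    \sum_(s <- words L n) \prod_(x <- s) p x * (n%:R - (sumn s)%:R).
  under [RHS]eq_bigr do rewrite mulrBr.
  rewrite sumrB cst; congr (_ - _).
  under [RHS]eq_bigr => s _ do rewrite sumnE natr_sum.
  by rewrite sum_words_prod_sum p1 expr1n mulr1 mean mulrC.
rewrite /eta mulrBl mul1r e1 -[X in _ - X]cst -sumrB /P1 mulr_suml.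
rewrite [leRHS]big_mkcond /= big_seq [leRHS]big_seq; apply: ler_sum => s.
rewrite mem_words => /andP[/eqP sn _]; rewrite -mulrBr.
have pp : 0 <= \prod_(x <- s) p x by apply: prodr_ge0.
case: ifP => ks.
  rewrite ler_wpM2l // -addrA gerDl -opprD oppr_le0.
  by rewrite addr_ge0 // ler0n.
rewrite mulr_ge0_le0 // -addrA -opprD subr_le0 -natrD ler_nat.
by move/negbT: ks; rewrite /excess sn -ltNge; lia.
Qed.

End SizeLowerBound.

(** * Slow variation *)

Section UniformConvergence.
Context {R : realType}.
Local Notation mu := (@lebesgue_measure R).

Lemma lebesgue_measure_shift (c : R) (A : set R) : measurable A ->
  mu ((fun x => x + c) @^-1` A) = mu A.
Proof.
have mf : measurable_fun [set: R] ((fun x => x + c) : R -> measurableTypeR R).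
  by apply: measurable_funD => //; exact: measurable_cst.
move=> mA; apply/esym.
pose nu := pushforward mu ((fun x => x + c) : R -> measurableTypeR R).
apply: (@lebesgue_measure_unique R nu) => //= _ [[a b]] _ <-.
rewrite /nu /pushforward.
rewrite (_ : _ @^-1` _ = `]a - c, b - c]%classic).
  rewrite !lebesgue_measure_itv/= !lte_fin ltrD2r -!EFinD.
  by rewrite opprB addrA subrK.
by apply/seteqP; split => x /=; rewrite !in_itv /= ltrBlDr lerBrDr.
Qed.

Variable h : R -> R.
Hypothesis mh : measurable_fun [set: R] h.

Let good (z : nat -> R) (e : R) n : set R :=
  `[0, 2] `&` \bigcap_(m in [set m | (n <= m)%N])
    [set v | `|h (z m + v) - h (z m)| <= e].

Let measurable_good (z : nat -> R) (e : R) n : measurable (good z e n).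
Proof.
apply: measurableI => //; apply: bigcap_measurable => [|m _].
  by exists n => /=.
pose f v := `|h (z m + v) - h (z m)|.
rewrite (_ : [set v | _] = setT `&` f @^-1` `]-oo, e]).
  have mf : measurable_fun setT f.
    apply: measurableT_comp => //; apply: measurable_funB => //.
    by apply: measurableT_comp => //; apply: measurable_funD.
  exact: mf.
by rewrite setTI; apply/seteqP; split => v /=; rewrite in_itv.
Qed.

Let good_large (z : nat -> R) (e : R) :
  (forall v : R, exists N, forall m, (N <= m)%N ->
    `|h (z m + v) - h (z m)| <= e) ->
  \forall n \near \oo, ((3 / 2)%:E < mu (good z e n))%E.
Proof.
move=> conv.
have nd : nondecreasing_seq (good z e).
  move=> n1 n2 n12; apply/subsetPset => v [v02 vn]; split=> // m /= n2m.
  by apply: vn => /=; apply: leq_trans n2m.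
have U : \bigcup_n good z e n = `[0, 2]%classic.
  apply/seteqP; split => [v [n _ []]//|v v02].
  by have [N HN] := conv v; exists N => //; split.
have := @nondecreasing_cvg_mu _ _ _ mu (good z e) (measurable_good z e).
rewrite U => /(_ _ nd) cv; have {cv} := cv (measurable_itv _).
have mu02 : mu `[0, 2]%classic = 2%:E.
  by rewrite lebesgue_measure_itv /= lte_fin ltr0n /= -?EFinB ?subr0.
move=> cv.
suff /cv : nbhs (mu `[0, 2]%classic) [set x | ((3 / 2)%:E < x)%E] by [].
rewrite mu02; apply: open_nbhs_nbhs; split; first exact: open_ereal_gt_ereal.
by rewrite /= lte_fin; lra.
Qed.

(** Karamata's uniform convergence theorem. If it failed along [x n] and
    [x n + u n], the sets of the shifts that are good for the two sequences
    would both fill more than three quarters of an interval of length 2. Once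
    the second one is translated by [u n], they lie in an interval of length 3,
    so that they meet; a common point compares [h (x n)] with
    [h (x n + u n)]. *)
Lemma uniform_convergence :
  (forall u e : R, 0 < e -> exists X : R, forall x : R, X <= x ->
    `|h (x + u) - h x| <= e) ->
  forall e : R, 0 < e -> exists X : R, forall x u : R, X <= x -> 0 <= u <= 1 ->
    `|h (x + u) - h x| <= e.
Proof.
move=> conv e e_gt0; apply/not_existsP => nX.
have {nX} ex n : exists xu : R * R, [/\ n%:R <= xu.1, 0 <= xu.2 <= 1 &
    e < `|h (xu.1 + xu.2) - h xu.1|].
  have := nX n%:R; move/existsNP => [x /existsNP[u /not_implyP[nx]]].
  move=> /not_implyP[u01 /negP]; rewrite -ltNge => exu.
  by exists (x, u).
have [xu Hxu] := choice ex.
pose x n : R := (xu n).1; pose y n : R := (xu n).1 + (xu n).2.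
have e2 : 0 < e / 2 by rewrite divr_gt0.
have conv_seq (z : nat -> R) : (forall n, n%:R <= z n) ->
  forall v, exists N, forall m,
    (N <= m)%N -> `|h (z m + v) - h (z m)| <= e / 2.
  move=> zn v; have [X HX] := conv v _ e2.
  exists (Num.truncn `|X|).+1 => m Xm; apply: HX.
  apply: le_trans (zn m); apply: (le_trans (ler_norm X)).
  by apply/ltW/(lt_le_trans (truncnS_gt _)); rewrite ler_nat.
have Gx : \forall n \near \oo, ((3 / 2)%:E < mu (good x (e / 2) n))%E.
  by apply/good_large/conv_seq => n; case: (Hxu n).
have Gy : \forall n \near \oo, ((3 / 2)%:E < mu (good y (e / 2) n))%E.
  apply/good_large/conv_seq => n; case: (Hxu n) => xn /andP[u0 _] _.
  by rewrite /y (le_trans xn) // lerDl.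
have [n [gx gy]] : exists n, ((3 / 2)%:E < mu (good x (e / 2) n))%E /\
    ((3 / 2)%:E < mu (good y (e / 2) n))%E.
  by have [n _ Hn] := filterI Gx Gy; exists n; apply: (Hn n) => /=.
have [xn /andP[u0 u1] far] := Hxu n.
pose A := good x (e / 2) n.
pose B := (fun v : R => v + - (xu n).2) @^-1` (good y (e / 2) n).
have mA : measurable A by exact: measurable_good.
have mB : measurable B.
  rewrite -[B]setTI.
  have mf : measurable_fun [set: R] (fun v : R => v + - (xu n).2).
    by apply: measurable_funD => //; exact: measurable_cst.
  by apply: mf => //; exact: measurable_good.
have AB0 : A `&` B = set0.
  apply/seteqP; split => // v.
  move=> [[_ /(_ n (leqnn n)) /= va] [_ /(_ n (leqnn n)) /= vb]].
  move: va vb far; rewrite /y /x.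
  rewrite (_ : _ + _ + (v + _) = (xu n).1 + v); last by ring.
  move=> va vb; apply/negP; rewrite -leNgt.
  apply: le_trans (ler_distD (h ((xu n).1 + v)) _ _) _.
  by rewrite distrC; lra.
have AB3 : A `|` B `<=` `[0, 3]%classic.
  move=> v [[/= + _]|[/= + _]]; rewrite !in_itv /= => /andP[v0 v2];
    apply/andP; split; lra.
have : (mu (A `|` B) <= mu `[0%R, 3%R]%classic)%E.
  by apply: le_measure; rewrite ?inE //; exact: measurableU.
rewrite measureU // lebesgue_measure_itv /= lte_fin ltr0n /= -?EFinB ?subr0.
rewrite leNgt => /negP; apply.
rewrite (_ : 3%:E = (3 / 2)%:E + (3 / 2)%:E :> \bar R)%E;
  last by rewrite -EFinD; congr _%:E; lra.
apply: lteD => //.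
by rewrite /B lebesgue_measure_shift //; exact: measurable_good.
Qed.

End UniformConvergence.

(** On the logarithmic scale, uniform convergence bounds by [1 / K] the decrease
    of [ln l] over any interval of length one that is far enough, hence its
    slope at large scale. *)
Lemma slowly_varying_lower (R : realType) (l : R -> R) (K : nat) :
  slowly_varying l -> (0 < K)%N ->
  exists c X : R, 0 < c /\ forall x, X <= x -> 0 < l x /\ c <= l x ^+ K * x.
Proof.
move=> [[a [ml l_gt0]] lc] K_gt0.
pose l' : R -> R := l \_ `[a, +oo[.
have ml' : measurable_fun [set: R] l' by apply/(measurable_restrictT _ _).1.
pose h (y : R) := ln (l' (expR y)).
have mh : measurable_fun [set: R] h.
  apply: measurableT_comp; first exact: measurable_ln.
  by apply: measurableT_comp; last exact: measurable_expR.
have l'E x : a <= x -> l' x = l x.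
  by move=> ax; rewrite /l' patchE ifT // inE /= in_itv /= ax.
have large (b : R) : exists2 Y : R, 0 <= Y & forall y, Y <= y -> b <= expR y.
  exists `|b| => // y by_; apply: le_trans (ler_norm b) _.
  by apply: le_trans by_ _; have := expR_ge1Dx y; lra.
have conv (u e : R) : 0 < e ->
    exists X : R, forall x : R, X <= x -> `|h (x + u) - h x| <= e.
  move=> e_gt0.
  have : ln (l (expR u * x) / l x) @[x --> +oo] --> (0 : R).
    rewrite -(@ln1 R); apply: cvg_comp (lc _ (expR_gt0 u)) _.
    by apply: continuous_ln.
  move/cvgrPdist_le => /(_ e e_gt0) [M [_ HM]].
  have [Y0 Y00 HY0] := large (`|M| + 1); have [Y1 _ HY1] := large a.
  exists (Num.max Y0 (Num.max Y1 (Y1 - u))) => x.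
  rewrite !ge_max => /and3P[Y0x Y1x Y1ux].
  have ax : a <= expR x by exact: HY1.
  have axu : a <= expR (x + u) by apply: HY1; lra.
  have /HM : M < expR x.
    by apply: lt_le_trans (HY0 _ Y0x); have := ler_norm M; lra.
  rewrite /= sub0r normrN -expRD ln_div ?posrE ?l_gt0 //; last by rewrite addrC.
  by rewrite /h !l'E // (addrC u).
pose e : R := K%:R^-1.
have K0 : (0 : R) < K%:R by rewrite ltr0n.
have e_gt0 : 0 < e by rewrite invr_gt0.
have [X0 HX0] := uniform_convergence mh conv e_gt0.
have [Y _ HY] := large a.
pose X := Num.max X0 Y.
have hX (j : nat) (y : R) : X <= y < X + j%:R + 1 ->
  h X - (y - X + 1) * e <= h y.
  have step (y1 : R) : X <= y1 -> forall u, 0 <= u <= 1 ->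
    h y1 - e <= h (y1 + u).
    move=> Xy1 u u01; have := HX0 y1 u; rewrite u01 => /(_ _ isT).
    have -> : X0 <= y1 by apply: le_trans Xy1; rewrite /X le_max lexx.
    by move=> /(_ isT); rewrite ler_distl => /andP[].
  elim: j y => [|j IH] y.
    move=> /andP[Xy yX]; have := step X (lexx _) (y - X).
    have -> : X + (y - X) = y by lra.
    have -> : 0 <= y - X <= 1 by apply/andP; split; lra.
    move=> /(_ isT); apply: le_trans; rewrite lerD2l lerN2.
    by rewrite ler_peMl ?(ltW e_gt0) //; lra.
  rewrite -natr1 => /andP[Xy yX].
  have [y1|y1] := ltP y (X + 1).
    by apply: IH; rewrite Xy /=; have : (0 : R) <= j%:R := ler0n _ _; lra.
  have := step (y - 1) _ 1; rewrite subrK ler01 lexx => s.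
  apply: le_trans (s _ isT); last by lra.
  have := IH (y - 1).
  have -> : X <= y - 1 < X + j%:R + 1 by apply/andP; split; lra.
  by move=> /(_ isT); lra.
exists (expR (K%:R * h X + X - 1)), (expR X); split; first exact: expR_gt0.
move=> x Xx.
have x_gt0 : 0 < x by apply: lt_le_trans Xx; exact: expR_gt0.
have ax : a <= x by apply: le_trans Xx; apply: HY; rewrite /X le_max lexx orbT.
split; first exact: l_gt0.
have Xlnx : X <= ln x by rewrite -ler_expR lnK.
have := hX (Num.truncn (ln x - X)) (ln x); rewrite Xlnx /=.
have -> : ln x < X + (Num.truncn (ln x - X))%:R + 1.
  by have := truncnS_gt (ln x - X); rewrite -natr1; lra.
have hlnx : h (ln x) = ln (l x) by rewrite /h lnK ?posrE // l'E.
rewrite hlnx => /(_ isT) H.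
have -> : l x ^+ K * x = expR (K%:R * ln (l x) + ln x).
  by rewrite expRD expRM_natl !lnK ?posrE ?l_gt0.
rewrite ler_expR.
have := ler_wpM2l (ltW K0) H; rewrite mulrBr mulrCA divff ?gt_eqF // mulr1.
by rewrite opprD; lra.
Qed.

(** * The offspring distribution *)

Lemma measure_bigcup_seq d (T : measurableType d) (R : realType)
    (mu : {measure set T -> \bar R}) (I : choiceType) (s : seq I)
    (F : I -> set T) :
  uniq s -> (forall i, i \in s -> measurable (F i)) -> trivIset [set` s] F ->
  mu (\bigcup_(i in [set` s]) F i) = (\sum_(i <- s) mu (F i))%E.
Proof.
move=> us mF tF; rewrite (measure_fin_bigcup _ (finite_seq s)) //.
by rewrite -fsbig_seq.
Qed.

Section OffspringDistribution.
Context {R : realType} (mu : probability nat R).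
Let m := pmass mu.

Lemma pmass_ge0 k : 0 <= m k.
Proof. by apply: fine_ge0. Qed.

Lemma pmassE k : mu [set k] = (m k)%:E.
Proof. by rewrite fineK // fin_num_measure. Qed.

Let sum_pmassE n : (\sum_(0 <= k < n) m k)%:E =
  mu (\bigcup_(k in [set` index_iota 0 n]) [set k]).
Proof.
rewrite measure_bigcup_seq ?iota_uniq //.
  by rewrite -sumEFin; apply: eq_bigr => k _; apply/esym/pmassE.
by apply/trivIsetP => i j _ _ ij; apply/seteqP; split => // x [/= -> /eqP];
  rewrite (negPf ij).
Qed.

Lemma sum_pmass_le1 n : \sum_(0 <= k < n) m k <= 1.
Proof. by rewrite -lee_fin sum_pmassE; apply: probability_le1. Qed.

Lemma sum_pmass_large (e : R) : 0 < e ->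
  exists n, 1 - e < \sum_(0 <= k < n) m k.
Proof.
move=> e_gt0.
pose F n : set nat := \bigcup_(k in [set` index_iota 0 n]) [set k].
have FT : \bigcup_n F n = setT.
  apply/seteqP; split => // k _; exists k.+1 => //; exists k => //=.
  by rewrite mem_index_iota /= ltnSn.
have := @nondecreasing_cvg_mu _ _ _ mu F (fun=> I) I.
have nd : nondecreasing_seq F.
  move=> i j ij; apply/subsetPset => x [k /= + ->].
  rewrite mem_index_iota /= => ki; exists k => //=.
  by rewrite mem_index_iota /= (leq_trans ki).
move=> /(_ nd); rewrite FT => cv.
suff /cv[N _ HN] : nbhs (mu [set: nat]) [set x | ((1 - e)%:E < x)%E].
  by exists N; rewrite -lte_fin sum_pmassE; apply: HN => /=.
rewrite probability_setT; apply: open_nbhs_nbhs; split;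
  first exact: open_ereal_gt_ereal.
by rewrite /= lte_fin; lra.
Qed.

Hypothesis mu_critical : critical mu.

Lemma sum_mean_le1 n : \sum_(0 <= k < n) k%:R * m k <= 1.
Proof.
have [E1 _] := mu_critical; rewrite unlock in E1; rewrite -lee_fin -E1.
have mall (f : nat -> \bar R) : measurable_fun setT f by [].
pose f k x : \bar R := (k%:R * \1_[set k] x)%:E.
have -> : (\sum_(0 <= k < n) k%:R * m k)%:E =
    (\int[mu]_x \sum_(0 <= k < n) f k x)%E.
  rewrite ge0_integral_sum //; last first.
    by move=> k x _; rewrite lee_fin mulr_ge0 ?ler0n // indicE ler0n.
  rewrite -sumEFin; apply: eq_bigr => k _; rewrite /f.
  under eq_integral do rewrite EFinM.
  rewrite ge0_integralZl_EFin ?ler0n //.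
  by rewrite integral_indic // setIT EFinM; congr (_ * _)%E; apply/esym/pmassE.
apply: ge0_le_integral => //.
  move=> x _; apply: sume_ge0 => k _.
  by rewrite lee_fin mulr_ge0 ?ler0n // indicE ler0n.
move=> x _; rewrite sumEFin lee_fin.
have [xn|xn] := ltnP x n.
  rewrite big_mkord (bigD1 (Ordinal xn)) //= indicE mem_set // mulr1.
  rewrite big1 ?addr0 // => i ix; rewrite indicE memNset ?mulr0 //= => xi.
  by move/eqP: ix; apply; apply/val_inj.
rewrite big_nat big1 ?ler0n // => k /andP[_ kn];
  rewrite indicE memNset ?mulr0 //=.
by move=> xk; move: xn; rewrite leqNgt xk kn.
Qed.

(** Markov's inequality for a distribution of mean at most one. *)
Lemma pmass_tail_le n : (0 < n)%N -> 1 - \sum_(0 <= k < n.+1) m k <= n%:R^-1.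
Proof.
move=> n_gt0; apply/ler_addgt0Pr => e /sum_pmass_large[N HN].
have n0 : (0 : R) < n%:R by rewrite ltr0n.
suff : \sum_(0 <= k < N) m k <= \sum_(0 <= k < n.+1) m k + n%:R^-1 by lra.
apply: (@le_trans _ _ (\sum_(0 <= k < maxn N n.+1) m k)).
  rewrite [leRHS](big_cat_nat (leq0n _) (leq_maxl N _)) //= lerDl sumr_ge0 //
    => k _; exact: pmass_ge0.
rewrite (big_cat_nat (leq0n _) (leq_maxr N n.+1)) //= lerD2l.
rewrite -(ler_pM2l n0) divff ?gt_eqF //.
apply: le_trans (sum_mean_le1 (maxn N n.+1)).
rewrite [leRHS](big_cat_nat (leq0n _) (leq_maxr N n.+1)) //= mulr_sumr.
apply: (@le_trans _ _ (\sum_(n.+1 <= k < maxn N n.+1) k%:R * m k)); last first.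
  by rewrite lerDr sumr_ge0 // => k _; rewrite mulr_ge0 ?ler0n ?pmass_ge0.
rewrite big_nat [leRHS]big_nat; apply: ler_sum => k /andP[nk _].
by rewrite ler_wpM2r ?pmass_ge0 // ler_nat ltnW.
Qed.

(** Mass above 1 pushes the mean above 1 unless some mass sits at 0. *)
Lemma pmass0_gt0 K : (1 < K)%N -> 0 < m K -> 0 < m 0%N.
Proof.
move=> K_gt1 mK; suff : m K <= m 0%N by apply: lt_le_trans.
apply/ler_addgt0Pr => e /sum_pmass_large[N HN].
have HN' : 1 - e < \sum_(0 <= k < maxn N K.+1) m k.
  apply: lt_le_trans HN _.
  rewrite [leRHS](big_cat_nat (leq0n _) (leq_maxl N _)) //= lerDl sumr_ge0 //
    => k _; exact: pmass_ge0.
set M := maxn N K.+1 in HN'.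
have KM : (K < M)%N by rewrite /M leq_maxr.
have := sum_mean_le1 M.
suff : \sum_(0 <= k < M) m k + m K - m 0%N <=
  \sum_(0 <= k < M) k%:R * m k by lra.
rewrite !big_mkord (bigD1 (Ordinal (ltn_trans (ltnW K_gt1) KM))) //=.
rewrite [leRHS](bigD1 (Ordinal (ltn_trans (ltnW K_gt1) KM))) //= mul0r add0r.
rewrite (bigD1 (Ordinal KM)) /=; last by rewrite -val_eqE /= -lt0n ltnW.
rewrite [leRHS](bigD1 (Ordinal KM)) /=; last by rewrite -val_eqE /= -lt0n ltnW.
set s1 := \sum_(i < M | _) _; set s2 := \sum_(i < M | _) _.
have s12 : s1 <= s2.
  apply: ler_sum => i /andP[i0 _]; rewrite ler_peMl ?pmass_ge0 // ler1n lt0n.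
  by move: i0; rewrite -val_eqE.
have : 2%:R * m K <= K%:R * m K by rewrite ler_wpM2r ?pmass_ge0 // ler_nat.
lra.
Qed.

End OffspringDistribution.

(** Consequences of the regular variation, in the form in which they are used:
    [r] stands for the integer [K]-th root of [n]. *)
Section RegularlyVaryingOffspring.
Context {R : realType} (mu : probability nat R).
Hypothesis mu_critical : critical mu.
Hypothesis mu_rv : regularly_varying_seq (- 2) (pmass mu).
Let m := pmass mu.

Lemma pmass_lower K : (0 < K)%N -> exists (c : R) (k0 : nat), 0 < c /\
  forall k, (k0 <= k)%N -> 0 < m k /\ c <= (k%:R ^+ 2 * m k) ^+ K * k%:R.
Proof.
move=> K_gt0; have [f f_rv [N _ HN]] := mu_rv.
have [c [X [c_gt0 HX]]] := slowly_varying_lower f_rv K_gt0.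
exists c, (maxn (Num.truncn `|X|).+1 N); split=> // k.
rewrite geq_max => /andP[Xk Nk].
have Xk' : X <= k%:R.
  apply: (le_trans (ler_norm X)).
  by apply/ltW/(lt_le_trans (truncnS_gt _)); rewrite ler_nat.
have k0 : (0 : R) < k%:R by rewrite ltr0n (leq_trans _ Xk).
have [l_gt0] := HX _ Xk'.
rewrite -(HN k Nk) opprK powR_mulrn ?(ltW k0) // in l_gt0 * => ->; split=> //.
by move: l_gt0; rewrite pmulr_rgt0 // exprn_gt0.
Qed.

Lemma pmass_lower_cube : exists (c : R) (k0 : nat), 0 < c /\
  forall n k, (k0 <= k <= n)%N -> (0 < n)%N -> c / n%:R ^+ 3 <= m k.
Proof.
have [c [k0 [c_gt0 H]]] := pmass_lower (ltnSn 0).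
exists c, k0; split=> // n k /andP[k0k kn] n_gt0.
have [mk_gt0] := H k k0k; rewrite expr1 => ck.
have n0 : (0 : R) < n%:R by rewrite ltr0n.
rewrite ler_pdivrMr ?exprn_gt0 //; apply: le_trans ck _.
rewrite mulrAC -exprSr mulrC ler_wpM2l ?(ltW mk_gt0) //.
by rewrite lerXn2r ?nnegrE ?ler0n // ler_nat.
Qed.

(** The values of [k] between [n] and [2 n] suffice: there are [n] of them, and
    each contributes [k * m k], of order at least [n ^ (- 1 - 1 / K)]. *)
Lemma mean_gap_lower K : (0 < K)%N -> exists (b : R) (n0 : nat), 0 < b /\
  forall n r, (n0 <= n)%N -> (n < r.+1 ^ K)%N ->
  b / r.+1%:R <= 1 - \sum_(0 <= k < n.+1) k%:R * m k.
Proof.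
move=> K_gt0; have [c [k0 [c_gt0 H]]] := pmass_lower K_gt0.
pose a := Num.min 1 (c / 2).
have a_gt0 : 0 < a by rewrite lt_min ltr01 divr_gt0.
exists (a / 2), (maxn 1 k0); split; first by rewrite divr_gt0.
move=> n r; rewrite geq_max => /andP[n_gt0 k0n] nr.
have n0 : (0 : R) < n%:R by rewrite ltr0n.
have r0 : (0 : R) < r.+1%:R by rewrite ltr0n.
have key k : (n < k <= n + n)%N -> a / r.+1%:R / (2 * n%:R) <= k%:R * m k.
  move=> /andP[nk k2n].
  have [mk_gt0 ck] := H k (leq_trans k0n (ltnW nk)).
  have k_gt0 : (0 : R) < k%:R by rewrite ltr0n (leq_trans _ nk).
  have k2n' : k%:R <= 2 * n%:R :> R by rewrite -natrM ler_nat mul2n -addnn.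
  (* A lower bound on [z ^ K] gives one on [z] without a [K]-th root, because
     the bound [a] is at most 1. *)
  pose z := k%:R ^+ 2 * m k * r.+1%:R.
  have z_ge0 : 0 <= z by rewrite !mulr_ge0 ?ler0n ?ltW.
  have zK : c / 2 <= z ^+ K.
    rewrite -(ler_pM2r n0).
    apply: (@le_trans _ _ (z ^+ K * (k%:R / (2 * n%:R)) * n%:R)); last first.
      rewrite ler_pM2r // ler_piMr ?exprn_ge0 //.
      by rewrite ler_pdivrMr ?mulr_gt0 ?ltr0n // mul1r.
    rewrite /z exprMn.
    have nrK : n%:R <= r.+1%:R ^+ K :> R by rewrite -natrX ler_nat ltnW.
    apply: (@le_trans _ _
      (((k%:R ^+ 2 * m k) ^+ K * k%:R) * (r.+1%:R ^+ K) / 2)); last first.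
      rewrite le_eqVlt; apply/orP; left; apply/eqP; field; lra.
    rewrite mulrAC ler_pM2r ?invr_gt0 ?ltr0n //.
    by apply: ler_pM => //; lra.
  have az : a <= z.
    rewrite leNgt; apply/negP => za; suff : a <= z by rewrite leNgt za.
    have a1 : a <= 1 by rewrite /a ge_min lexx.
    have ac : a <= c / 2 by rewrite /a ge_min lexx orbT.
    apply: (le_trans ac); apply: (le_trans zK).
    case: (K) K_gt0 => // K' _; rewrite exprS ler_piMr // exprn_ile1 //.
    by apply: ltW; apply: lt_le_trans za a1.
  rewrite ler_pdivrMr ?mulr_gt0 ?ltr0n // ler_pdivrMr //.
  apply: (le_trans az); rewrite /z.
  rewrite [leRHS](_ : _ = k%:R * m k * r.+1%:R * (2 * n%:R)); last by ring.
  rewrite [leLHS](_ : _ = k%:R * m k * r.+1%:R * k%:R); last by ring.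
  by rewrite ler_wpM2l // !mulr_ge0 ?ler0n ?ltW.
have := sum_mean_le1 mu_critical (n + n).+1.
rewrite (@big_cat_nat _ _ _ n.+1 0 (n + n).+1) //=;
  last by rewrite ltnS leq_addr.
set s1 := \sum_(0 <= _ < _) _; set s2 := \sum_(_ <= _ < _) _ => s12.
suff as2 : a / 2 / r.+1%:R <= s2 by apply: (le_trans as2); rewrite lerBrDl.
apply: (@le_trans _ _ (\sum_(n.+1 <= k < (n + n).+1) a / r.+1%:R / (2 * n%:R))).
  rewrite sumr_const_nat subSS addnK -mulr_natl le_eqVlt; apply/orP; left.
  by apply/eqP; field; rewrite !gt_eqF.
rewrite big_nat [leRHS]big_nat; apply: ler_sum => k /andP[nk kn].
by apply: key; rewrite nk -ltnS.
Qed.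

End RegularlyVaryingOffspring.

(** * The walk *)

Definition in_box d (J : nat) : pred (lattice d) :=
  fun x => [forall i : 'I_d, `|(x : 'rV[int]_d) ord0 i| <= J%:Z].

(** A point of the box is coded by its coordinates shifted by [J]. *)
Definition box_decode d (J : nat) (f : {ffun 'I_d -> 'I_(J + J).+1}) :
    lattice d :=
  (\row_i ((f i : nat)%:Z - J%:Z) : 'rV[int]_d).

Definition box d (J : nat) : seq (lattice d) :=
  map (@box_decode d J) (enum {ffun 'I_d -> 'I_(J + J).+1}).

Lemma mem_box d J x : (x \in box d J) = in_box J x.
Proof.
apply/mapP/forallP => [[f _ ->] i|H].
  by rewrite mxE ler_norml; have := ltn_ord (f i);
    move: (nat_of_ord (f i)) => k; lia.
have {}H i : - J%:Z <= (x : 'rV[int]_d) ord0 i <= J%:Z by rewrite -ler_norml.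
exists [ffun i => inord `|((x : 'rV[int]_d) ord0 i + J%:Z)%R|%N].
  by rewrite mem_enum.
apply/rowP => i; rewrite mxE ffunE; have := H i.
by move: ((x : 'rV[int]_d) ord0 i) => z Hz; rewrite inordK; lia.
Qed.

Lemma uniq_box d J : uniq (box d J).
Proof.
rewrite map_inj_uniq ?enum_uniq // => f g /rowP fg; apply/ffunP => i.
by apply: ord_inj; have := fg i; rewrite !mxE => /addIr [].
Qed.

Lemma size_box d J : size (box d J) = ((J + J).+1 ^ d)%N.
Proof. by rewrite size_map -cardE card_ffun !card_ord. Qed.

Lemma in_boxD d J J' (x y : lattice d) :
  in_box J x -> in_box J' y -> in_box (J + J') (x + y).
Proof.
move=> /forallP Hx /forallP Hy; apply/forallP => i; rewrite mxE.
by apply: le_trans (ler_normD _ _) _; rewrite PoszD lerD.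
Qed.

Lemma in_box_le d J J' (x : lattice d) :
  (J <= J')%N -> in_box J x -> in_box J' x.
Proof.
by move=> JJ' /forallP H; apply/forallP => i; apply: le_trans (H i) _.
Qed.

Definition parent (u : seq nat) := take (size u).-1 u.

Lemma parent_rcons v i : parent (rcons v i) = v.
Proof. by rewrite /parent size_rcons /= -cats1 take_size_cat. Qed.

(** A vertex is reached from the root by at most [h] jumps, so that the walk
    stays in a box of side of order [J * h], whatever the number of vertices. *)
Lemma walk_range_le d t (W : seq nat -> lattice d) J h :
  W [::] = 0 -> (height t <= h)%N ->
  (forall v i, rcons v i \in vertices t -> in_box J (W (rcons v i) - W v)) ->
  (walk_range t W <= (J * h + J * h).+1 ^ d)%N.
Proof.
move=> W0 th jump.
have inb u : u \in vertices t -> in_box (J * size u) (W u).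
  elim/last_ind: u => [|v i IH] ut.
    by rewrite W0 muln0; apply/forallP => i; rewrite mxE.
  rewrite size_rcons mulnS -(subrK (W v) (W (rcons v i))).
  by apply: in_boxD; [exact: jump|apply/IH/vertices_prefix/ut].
rewrite -size_box; apply: uniq_leq_size; first exact: undup_uniq.
move=> x; rewrite mem_undup => /mapP[u ut ->]; rewrite mem_box.
by apply: in_box_le (inb u ut);
  rewrite leq_mul2l (leq_trans (size_vertex ut)) ?orbT.
Qed.

Section TreeWalk.
Context {R : realType} (d : nat) (theta : probability (lattice d) R).
Context disp (Omega : measurableType disp) (P : probability Omega R).
Context (T : {RV P >-> tree}) (W : Omega -> seq nat -> lattice d).
Hypothesis walkW : is_tree_walk theta T W.

Lemma measurable_tree_eq t : measurable (T @^-1` [set t]).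
Proof. by rewrite -[X in measurable X]setTI; apply: measurable_funPT. Qed.

(** The event only depends on finitely many positions, which take their values
    in a countable set. *)
Lemma measurable_walk t (Q : (seq nat -> lattice d) -> Prop) :
  (forall W1 W2, {in vertices t, W1 =1 W2} -> Q W1 -> Q W2) ->
  measurable (T @^-1` [set t] `&` [set w | Q (W w)]).
Proof.
move=> Qloc.
have mvalues (us : seq (seq nat)) (l : seq (lattice d)) :
    {subset us <= vertices t} ->
    measurable (T @^-1` [set t] `&` [set w | [seq W w u | u <- us] = l]).
  elim: us l => [|u us IH] l ust.
    case: l => [|x l].
      rewrite (_ : [set w | _] = setT) ?setIT; first exact: measurable_tree_eq.
      by apply/seteqP; split.
    rewrite (_ : [set w | _] = set0) ?setI0; first exact: measurable0.
    by apply/seteqP; split.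
  case: l => [|x l].
    rewrite (_ : [set w | _] = set0) ?setI0; first exact: measurable0.
    by apply/seteqP; split.
  rewrite (_ : _ `&` _ = (T @^-1` [set t] `&` (W ^~ u) @^-1` [set x]) `&`
      (T @^-1` [set t] `&` [set w | [seq W w u | u <- us] = l])).
    apply: measurableI.
      by apply: (walk_measurable walkW) => //; [apply: ust;
        rewrite mem_head|exact: measurable_tree_eq].
    by apply: IH => v vus; apply: ust; rewrite inE vus orbT.
  by apply/seteqP; split => w /= => [[? [-> ->]]|[[? ->] [_ ->]]].
pose ext (l : seq (lattice d)) u :=
  nth (0 : lattice d) l (index u (vertices t)).
rewrite (_ : _ `&` _ = \bigcup_(l : seq (lattice d))
    (T @^-1` [set t] `&`
     [set w | [seq W w u | u <- vertices t] = l /\ Q (ext l)])).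
  apply: countable_bigcupT_measurable => [|l]; first exact: countableP.
  have [Ql|nQl] := pselect (Q (ext l)).
    rewrite (_ : [set w | _ /\ _] =
      [set w | [seq W w u | u <- vertices t] = l]).
      exact: mvalues.
    by apply/seteqP; split => w /= => [[]|].
  rewrite (_ : [set w | _ /\ _] = set0) ?setI0; first exact: measurable0.
  by apply/seteqP; split => w //= [].
have extE w : {in vertices t, ext [seq W w u | u <- vertices t] =1 W w}.
  by move=> u ut; rewrite /ext (nth_map [::]) ?index_mem // nth_index.
apply/seteqP; split => [w /= [Tw Qw]|w [l _ /= [Tw [<- Ql]]]].
  exists [seq W w u | u <- vertices t] => //=; split=> //; split=> //.
  by apply: Qloc Qw => u ut; rewrite extE.
by split=> //; apply: Qloc Ql; exact: extE.
Qed.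

Definition jumps_in (L : seq (lattice d)) t : set Omega := T @^-1` [set t] `&`
  [set w | forall v i, rcons v i \in vertices t ->
    W w (rcons v i) - W w v \in L].

Let prescribed t (x : seq nat -> lattice d) : set Omega := T @^-1` [set t] `&`
  [set w | forall v i, rcons v i \in vertices t ->
    W w (rcons v i) - W w v = x (rcons v i)].

Let measurable_prescribed t x : measurable (prescribed t x).
Proof.
apply: (@measurable_walk t (fun W0 => forall v i, rcons v i \in vertices t ->
  W0 (rcons v i) - W0 v = x (rcons v i))) => W1 W2 W12 H v i vit.
by rewrite -!W12 ?H //; apply: vertices_prefix vit.
Qed.

Lemma measurable_jumps_in L t : measurable (jumps_in L t).
Proof.
apply: (@measurable_walk t (fun W0 => forall v i, rcons v i \in vertices t ->
  W0 (rcons v i) - W0 v \in L)) => W1 W2 W12 H v i vit.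
by rewrite -!W12 ?H //; apply: vertices_prefix vit.
Qed.

(** The law of the walk is given for prescribed jumps, so the event is cut
    according to the word of the jumps along an enumeration of the edges. *)
Lemma prob_jumps_in (L : seq (lattice d)) t : uniq L ->
  P (jumps_in L t) = (P (T @^-1` [set t]) *
    ((\sum_(x <- L) fine (theta [set x])) ^+ (size (vertices t)).-1)%:E)%E.
Proof.
move=> uL.
pose V := [seq u <- vertices t | u != [::]].
have uV : uniq V by rewrite filter_uniq // uniq_vertices.
have sV : size V = (size (vertices t)).-1.
  case: (t) @V uV => ts V _; rewrite /V /= -/(child_vertices 0 ts).
  by congr size; apply/all_filterP/allP => v /child_verticesP[j [u ->]].
have rV v i : (rcons v i \in V) = (rcons v i \in vertices t).
  by rewrite mem_filter; case: (v).
have VP u : u \in V -> exists v i, u = rcons v i.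
  by rewrite mem_filter; elim/last_ind: u => // v i _ _; exists v, i.
pose x (l : seq (lattice d)) u := nth (0 : lattice d) l (index u V).
have xE l u i : size l = size V -> (i < size V)%N ->
  x l (nth u V i) = nth (0 : lattice d) l i.
  by move=> lV iV; rewrite /x index_uniq.
have -> : jumps_in L t =
    \bigcup_(l in [set` words L (size V)]) prescribed t (x l).
  apply/seteqP; split => [w [Tw Hw]|w [l /=]].
    pose l := [seq W w u - W w (parent u) | u <- V].
    exists l => /=.
      rewrite mem_words size_map eqxx; apply/allP => _ /mapP[u uV' ->] /=.
      by have [v [i E]] := VP u uV'; rewrite E parent_rcons Hw // -rV -E.
    split=> // v i vit; rewrite -rV in vit.
    by rewrite /x (nth_map [::]) ?index_mem // nth_index // parent_rcons.
  rewrite mem_words => /andP[/eqP lV /allP lL] [Tw Hw]; split=> // v i vit.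
  by rewrite Hw //; apply/lL/mem_nth; rewrite lV index_mem rV.
rewrite measure_bigcup_seq ?uniq_words //; last first.
  apply/trivIsetP => l l' /= + + ll'; rewrite !mem_words.
  move=> /andP[/eqP lV _] /andP[/eqP l'V _].
  apply/seteqP; split => // w [[_ Hw] [_ Hw']].
  move/eqP: ll'; apply; apply: (@eq_from_nth _ 0); first by rewrite lV l'V.
  move=> i; rewrite lV => iV; rewrite -!(xE _ [::]) //.
  have iV' := mem_nth [::] iV; have [v [j E]] := VP _ iV'.
  by rewrite E -Hw -?Hw' // -rV -E.
rewrite -sV -sum_words_prod -sumEFin ge0_sume_distrr; last first.
  by move=> l _; rewrite lee_fin prodr_ge0 // => y _; apply: fine_ge0.
rewrite big_seq [RHS]big_seq; apply: eq_bigr => l.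
rewrite mem_words => /andP[/eqP lV _];
  apply: etrans (walk_increments walkW t (x l)) _.
congr (_ * _)%E; rewrite -[LHS]big_filter -/V -prodEFin.
rewrite [in RHS](_ : l = [seq x l u | u <- V]); last first.
  apply: (@eq_from_nth _ 0); first by rewrite size_map.
  by move=> i iV; rewrite lV in iV; rewrite (nth_map [::]) // xE.
by rewrite big_map; apply: eq_bigr => u _; rewrite fineK // fin_num_measure.
Qed.

Lemma prob_jumps_in_bigcup (L : seq (lattice d)) n (s : seq tree) :
  uniq L -> uniq s -> {in s, forall t, size (vertices t) = n.+1} ->
  P (\bigcup_(t in [set` s]) jumps_in L t) =
  ((\sum_(t <- s) P (T @^-1` [set t])) *
    ((\sum_(x <- L) fine (theta [set x])) ^+ n)%:E)%E.
Proof.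
move=> uL us sn; rewrite measure_bigcup_seq //; last 2 first.
- by move=> t _; exact: measurable_jumps_in.
- apply/trivIsetP => t t' _ _ tt'; apply/seteqP;
  split => // w [[/= Tw _] [/= Tw' _]].
  by move/eqP: tt'; apply; rewrite -Tw -Tw'.
rewrite ge0_sume_distrl // big_seq [RHS]big_seq; apply: eq_bigr => t ts.
by apply: etrans (prob_jumps_in t uL) _; rewrite sn.
Qed.

Lemma measurable_range_gt (a : R) n : measurable
  [set w | a < (walk_range (T w) (W w))%:R / n%:R].
Proof.
rewrite (_ : [set w | _] = \bigcup_(t : tree) (T @^-1` [set t] `&`
    [set w | a < (walk_range t (W w))%:R / n%:R])).
  apply: countable_bigcupT_measurable => [|t]; first exact: countableP.
  apply: (@measurable_walk t (fun W0 => a < (walk_range t W0)%:R / n%:R)).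
  move=> W1 W2 W12; rewrite /walk_range.
  by have -> : map W1 (vertices t) = map W2 (vertices t) by apply/eq_in_map.
by apply/seteqP; split => [w aw|w [t _ [/= <-]]//]; exists (T w).
Qed.

End TreeWalk.

(** Markov's inequality for the [A]-th power of the norm, which is at least [J]
    outside of the box. *)
Lemma box_mass_ge (R : realType) d (theta : probability (lattice d) R)
    (A : nat) : finite_moments theta -> (0 < A)%N ->
  exists2 M : R, 0 <= M & forall J, (0 < J)%N ->
  1 - M / J%:R ^+ A <= \sum_(x <- box d J) fine (theta [set x]).
Proof.
move=> mom A_gt0; have A0 : (0 : R) < A%:R by rewrite ltr0n.
pose E := ('E_theta[fun x => (euclidean_norm R x `^ A%:R)%R])%E.
have E_ge0 : (0 <= E)%E by apply: expectation_ge0 => x; exact: powR_ge0.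
have Efin : E \is a fin_num by rewrite ge0_fin_numE //; apply: mom.
exists (fine E); first exact: fine_ge0.
move=> J J_gt0; have J0 : (0 : R) < J%:R by rewrite ltr0n.
pose B : set (lattice d) := [set x | x \in box d J].
have -> : \sum_(x <- box d J) fine (theta [set x]) = fine (theta B).
  have -> : B = \bigcup_(x in [set` box d J]) [set x].
    by apply/seteqP; split => [x Bx|x [y yb ->]//]; exists x.
  apply: EFin_inj; rewrite fineK ?fin_num_measure // measure_bigcup_seq
    ?uniq_box //.
    by rewrite -sumEFin; apply: eq_bigr => x _;
      rewrite fineK // fin_num_measure.
  apply/trivIsetP => x y _ _ xy; apply/seteqP; split => // z [/= -> /eqP].
  by rewrite (negPf xy).
have TC : (theta (~` B) = 1 - theta B)%E by rewrite probability_setC.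
have far x : (~` B) x -> J%:R <= euclidean_norm R x.
  move=> /negP; rewrite /= mem_box => /forallPn[i]; rewrite -ltNge => Ji.
  apply: (@le_trans _ _ `|coordinate R i x|).
    by rewrite /coordinate -intr_norm -[leLHS]/((J%:Z)%:~R) ler_int ltW.
  rewrite -sqrtr_sqr ler_wsqrtr // (bigD1 i) //= lerDl sumr_ge0 // => j _.
  exact: sqr_ge0.
have key : ((J%:R ^+ A)%:E * theta (~` B) <= E)%E.
  rewrite /E unlock -[~` B]setIT -[theta _]integral_indic //.
  rewrite -ge0_integralZl_EFin //.
  apply: ge0_le_integral => //.
  move=> x _; rewrite -EFinM lee_fin indicE.
  have [Bx|nBx] := pselect ((~` B) x).
    rewrite mem_set // mulr1 -powR_mulrn ?(ltW J0) //.
    by rewrite ge0_ler_powR ?nnegrE ?ler0n ?sqrtr_ge0 // far.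
  by rewrite memNset // mulr0 powR_ge0.
have thB : theta B = (fine (theta B))%:E by rewrite fineK // fin_num_measure.
rewrite TC thB -(fineK Efin) -EFinB -EFinM lee_fin in key.
rewrite lerBlDr -lerBlDl ler_pdivlMr ?exprn_gt0 //.
by rewrite mulrC.
Qed.

(** * Trees of a given size *)

Definition trees_of_size (n : nat) : seq tree :=
  [seq t <- bounded_trees n n.+1 | size (offspring_numbers t) == n.+1].

Lemma mem_trees_of_size n t :
  (t \in trees_of_size n) = (size (vertices t) == n.+1).
Proof.
rewrite mem_filter size_vertices; case: eqP => // sz.
rewrite andTb mem_bounded_trees -[X in (_ < X)%N]sz height_lt andTb.
by apply/allP => k /offspring_number_lt; rewrite sz ltnS.
Qed.

Lemma uniq_trees_of_size n : uniq (trees_of_size n).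
Proof. by rewrite filter_uniq // uniq_bounded_trees. Qed.

Section TreesOfSize.
Context {R : realType} (mu : probability nat R).
Let m := pmass mu.

Lemma bienayme_sizeE n :
  bienayme_size mu n = (\sum_(t <- trees_of_size n) tree_weight m t)%:E.
Proof.
rewrite /bienayme_size (_ : has_size n = [set` trees_of_size n]); last first.
  by apply/seteqP; split => t /=; rewrite mem_trees_of_size => /eqP.
rewrite esum_fset; first by rewrite -fsbig_seq ?uniq_trees_of_size // sumEFin.
  exact: finite_seq.
by move=> t _; rewrite lee_fin; apply: (@tree_weight_ge0 _ m (pmass_ge0 mu)).
Qed.

Hypothesis mu_critical : critical mu.
Hypothesis mu_rv : regularly_varying_seq (- 2) (pmass mu).

(** The lower bound is the product of the weight [m k] of the root, of order at
    least [n ^ (- 3)], of a factor [1 / n] for the rotations and of the mean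
    gap, of order at least [1 / (r + 1)]; moreover, [n < (r + 1) ^ K]. *)
Lemma trees_of_size_lower K : (1 < K)%N -> exists (c : R) (r0 : nat), 0 < c /\
  forall n r, (r0 <= r)%N -> (r ^ K <= n < r.+1 ^ K)%N ->
  c / r.+1%:R ^+ (4 * K).+1 <= \sum_(t <- trees_of_size n) tree_weight m t.
Proof.
move=> K_gt1; have K_gt0 := ltnW K_gt1.
have [c [k0' [c_gt0 mlow]]] := pmass_lower_cube mu_rv.
have [b [n0 [b_gt0 gap]]] := mean_gap_lower mu_critical mu_rv K_gt0.
pose k0 := k0'.+1.
have m0_gt0 : 0 < m 0%N.
  have [c1 [k1 [_ H]]] := pmass_lower mu_rv K_gt0.
  apply: (@pmass0_gt0 _ _ mu_critical (maxn 2 k1)); first by rewrite leq_max.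
  by case: (H (maxn 2 k1) (leq_maxr _ _)).
pose Ex := expR ((m 0%N)^-1).
have Ex_gt0 : 0 < Ex := expR_gt0 _.
pose r0 := maxn (maxn 1 n0) (Num.truncn (4 * k0%:R / b)).+1.
exists (c * b / (2 * Ex)), r0; split.
  by rewrite divr_gt0 ?mulr_gt0 ?ltr0n.
move=> n r; rewrite !geq_max => /andP[/andP[r_gt0 n0r] k0r] /andP[rn nr].
have r0' : (0 : R) < r%:R by rewrite ltr0n.
have r2n : (r ^ 2 <= n)%N by apply: leq_trans rn; rewrite leq_pexp2l.
have rlen : (r <= n)%N by apply: leq_trans r2n; rewrite -mulnn leq_pmulr.
have n_gt0 : (0 < n)%N by exact: leq_trans rlen.
have n0' : (0 : R) < n%:R by rewrite ltr0n.
have r1 : (0 : R) < r.+1%:R by rewrite ltr0n.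
have m_ge0 := pmass_ge0 mu.
have m_le1 := sum_pmass_le1 mu n.+1.
have step1 := sum_trees_of_size_ge m_ge0 (fun k (H : (k0 <= k <= n)%N) =>
  mlow n k
  (introT andP (conj (ltnW (andP H).1) (andP H).2)) n_gt0).
have step2 := sum_forest_words n m_ge0 (ltn0Sn k0').
have step3 := @sum_words_excess_ge R m n m_ge0 m_le1 k0 (1 + (n%:R * m 0%N)^-1).
have {step3} := step3 n_gt0.
have -> : 1 <= 1 + (n%:R * m 0%N)^-1 by rewrite lerDl invr_ge0 mulr_ge0 ?ltW.
move=> /(_ isT).
have -> : m 0%N + (1 - \sum_(0 <= k < n.+1) m k) <=
    (1 + (n%:R * m 0%N)^-1) * m 0%N.
  rewrite mulrDl mul1r lerD2l invfM mulfVK ?gt_eqF //.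
  exact: pmass_tail_le.
move=> /(_ isT) step3.
set S := \sum_(t <- trees_of_size n) _.
set S1 := \sum_(s <- words _ n | forest_word s && _) _ in step1 step2.
set S2 := \sum_(s <- words _ n | _) _ in step2 step3.
have S1_ge0 : 0 <= S1 by apply: sumr_ge0 => s _; apply: prodr_ge0.
have S2_ge0 : 0 <= S2 by apply: sumr_ge0 => s _; apply: prodr_ge0.
have step1' : c / n%:R ^+ 3 * S1 <= S by rewrite /S big_filter.
(* The tail beyond [n] is at most [1 / n], so the change of measure costs a
   bounded factor. *)
have kappa_le : (1 + (n%:R * m 0%N)^-1) ^+ n <= Ex.
  have -> : Ex = expR (n%:R * m 0%N)^-1 ^+ n.
    by rewrite -expRM_natl invfM mulrA divff ?gt_eqF // mul1r.
  rewrite lerXn2r ?nnegrE ?expR_ge0 ?expR_ge1Dx //.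
  by rewrite addr_ge0 // invr_ge0 mulr_ge0 ?ltW.
have gap' : b / r.+1%:R / 2 <= Ex * S2.
  apply: le_trans (le_trans step3 _); last by rewrite ler_wpM2r.
  have gn := gap n r (leq_trans n0r rlen) nr.
  suff k0n : k0%:R / n%:R <= b / r.+1%:R / 2.
    by apply: le_trans (lerB gn k0n); rewrite [X in _ <= X - _]splitr addrK.
  have k0r' : 4 * k0%:R / b <= r%:R.
    by apply/ltW/(lt_le_trans (truncnS_gt _)); rewrite ler_nat.
  rewrite ler_pdivrMr // in k0r'.
  have r2n' : r%:R ^+ 2 <= n%:R :> R by rewrite -natrX ler_nat.
  have r12 : r.+1%:R <= 2 * r%:R :> R by rewrite -natrM ler_nat mul2n -addnn
    -addn1 leq_add2l.
  rewrite ler_pdivrMr // (_ : b / _ / 2 * _ = b * n%:R / (2 * r.+1%:R));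
    last first.
    by field; rewrite gt_eqF.
  rewrite ler_pdivlMr ?mulr_gt0 ?ltr0n //.
  apply: (@le_trans _ _ (b * r%:R ^+ 2)); last by rewrite ler_wpM2l // ltW.
  apply: (@le_trans _ _ (k0%:R * (2 * (2 * r%:R)))).
    by rewrite ler_wpM2l ?ler0n // ler_wpM2l ?ler0n.
  rewrite (_ : k0%:R * _ = 4 * k0%:R * r%:R); last by ring.
  by rewrite (_ : b * _ = r%:R * b * r%:R) ?ler_wpM2r ?ler0n //; ring.
have n4 : n%:R ^+ 4 <= r.+1%:R ^+ (4 * K) :> R.
  rewrite mulnC exprM lerXn2r ?nnegrE ?exprn_ge0 ?ler0n //.
  by rewrite -natrX ler_nat ltnW.
apply: le_trans step1'.
have S1_low : b / r.+1%:R / 2 <= Ex * (n%:R * S1).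
  by apply: le_trans gap' _; rewrite ler_wpM2l // ltW.
have n3 : 0 < n%:R ^+ 3 :> R by rewrite exprn_gt0.
have n40 : 0 < n%:R ^+ 4 :> R by rewrite exprn_gt0.
apply: (@le_trans _ _ (c * b / (2 * Ex) / (r.+1%:R * n%:R ^+ 4))).
  have coef : 0 <= c * b / (2 * Ex) by rewrite divr_ge0 ?mulr_ge0 ?ltW.
  rewrite ler_wpM2l //.
  by rewrite lef_pV2 ?posrE ?mulr_gt0 ?exprn_gt0 // [leRHS]exprS ler_wpM2l
    ?(ltW r1).
rewrite (_ : c * b / _ / _ = c / (Ex * n%:R ^+ 4) * (b / r.+1%:R / 2));
  last first.
  by field; rewrite !gt_eqF.
apply: (@le_trans _ _ (c / (Ex * n%:R ^+ 4) * (Ex * (n%:R * S1)))).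
  by rewrite ler_wpM2l // divr_ge0 ?mulr_ge0 ?ltW.
by rewrite le_eqVlt; apply/orP; left; apply/eqP; field; rewrite !gt_eqF.
Qed.

(** The truncated mean makes the high trees decay like [exp (- b r / 2)], which
    beats the polynomial lower bound on the weight of all the trees. *)
Lemma high_trees_negligible K : (1 < K)%N -> exists (C : R) (r0 : nat),
  forall n r, (r0 <= r)%N -> (r ^ K <= n < r.+1 ^ K)%N ->
  0 < \sum_(t <- trees_of_size n) tree_weight m t /\
  \sum_(t <- trees_of_size n | (r ^ 2 <= height t)%N) tree_weight m t <=
    C / r%:R * \sum_(t <- trees_of_size n) tree_weight m t.
Proof.
move=> K_gt1; have K_gt0 := ltnW K_gt1.
have [c [r0 [c_gt0 low]]] := trees_of_size_lower K_gt1.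
have [b [n0 [b_gt0 gap]]] := mean_gap_lower mu_critical mu_rv K_gt0.
pose j := (4 * K).+2.
exists ((2 * j%:R / b) ^+ j * 2 ^+ (4 * K).+1 / c), (maxn (maxn 1 n0) r0).
move=> n r.
rewrite !geq_max => /andP[/andP[r_gt0 n0r] r0r] rn.
have r0' : (0 : R) < r%:R by rewrite ltr0n.
have r1 : (0 : R) < r.+1%:R by rewrite ltr0n.
have rlen : (r <= n)%N.
  case/andP: rn => rn _; apply: leq_trans rn.
  by rewrite -{1}(expn1 r) leq_pexp2l.
have {low} := low n r r0r rn; set S := \sum_(t <- trees_of_size n) _ => low.
have S_gt0 : 0 < S by apply: lt_le_trans low; rewrite divr_gt0 // exprn_gt0.
split=> //.
have m_ge0 := pmass_ge0 mu.
have w_ge0 := tree_weight_ge0 m_ge0.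
pose mean := \sum_(0 <= k < n.+1) k%:R * m k.
have mean_ge0 : 0 <= mean by apply: sumr_ge0 => k _; rewrite mulr_ge0 ?ler0n.
have mean_le : mean <= expR (- (b / r.+1%:R)).
  apply: le_trans (expR_ge1Dx _).
  by have := gap n r (leq_trans n0r rlen) (andP rn).2;
    rewrite lerBrDl addrC -lerBrDl.
(* The power [j] of [1 / r] in [exp_y] exceeds by one that of the lower bound
   on the weight of all the trees. *)
pose y := b * r%:R / 2.
have y_gt0 : 0 < y by rewrite /y divr_gt0 ?mulr_gt0 ?ltr0n.
have j0 : (0 : R) < j%:R by rewrite ltr0n.
have exp_y : expR (- y) <= (j%:R / y) ^+ j.
  have -> : - y = j%:R * - (y / j%:R) by field; rewrite gt_eqF.
  have jy : 0 <= j%:R / y by apply: divr_ge0; apply: ltW.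
  rewrite expRM_natl lerXn2r ?nnegrE ?expR_ge0 ?jy //.
  rewrite expRN -[leRHS]invf_div lef_pV2 ?posrE ?expR_gt0 ?(divr_gt0 y_gt0 j0)
    //.
  by apply: le_trans (expR_ge1Dx _); rewrite lerDr.
have high : \sum_(t <- trees_of_size n | (r ^ 2 <= height t)%N)
    tree_weight m t <= expR (- y).
  apply: (@le_trans _ _ (mean ^+ (r ^ 2))).
    apply: le_trans
      (sum_bounded_trees_high m_ge0 (sum_pmass_le1 mu) n n.+1 (r ^ 2)).
    rewrite big_filter_cond [leLHS]big_mkcond [leRHS]big_mkcond /=.
    by apply: ler_sum => t _; case: (_ == _) => //=; case: ifP.
  apply: (@le_trans _ _ (expR (- (b / r.+1%:R)) ^+ (r ^ 2))).
    by rewrite lerXn2r ?nnegrE ?expR_ge0.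
  rewrite -expRM_natl ler_expR mulrN lerN2 /y natrX.
  have r12 : r.+1%:R <= 2 * r%:R :> R by rewrite -natrM ler_nat mul2n -addnn
    -addn1 leq_add2l.
  rewrite mulrA ler_pdivlMr //.
  apply: (@le_trans _ _ (b * r%:R / 2 * (2 * r%:R)));
    first by rewrite ler_wpM2l // ltW.
  by rewrite le_eqVlt; apply/orP; left; apply/eqP; field.
apply: (le_trans high); apply: (le_trans exp_y).
pose D := (2 * j%:R / b) ^+ j.
have D_ge0 : 0 <= D.
  by rewrite exprn_ge0 // divr_ge0 ?mulr_ge0 ?(ltW j0) ?(ltW b_gt0).
apply: (@le_trans _ _ ((2 * j%:R / b) ^+ j * 2 ^+ (4 * K).+1 / c / r%:R *
    (c / r.+1%:R ^+ (4 * K).+1))); last first.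
  rewrite ler_wpM2l // divr_ge0 ?ler0n // divr_ge0 ?(ltW c_gt0) //.
  by apply: mulr_ge0; [exact: D_ge0|exact: exprn_ge0].
have -> : j%:R / y = 2 * j%:R / b / r%:R by rewrite /y; field; rewrite !gt_eqF.
rewrite exprMn exprVn.
rewrite -/D.
have rr : r.+1%:R ^+ (4 * K).+1 <= 2 ^+ (4 * K).+1 * r%:R ^+ (4 * K).+1 :> R.
  rewrite -exprMn lerXn2r ?nnegrE ?mulr_ge0 ?ler0n //.
  by rewrite -natrM ler_nat mul2n -addnn -addn1 leq_add2l.
rewrite /j exprS invfM.
set u := r%:R ^+ (4 * K).+1 in rr *; set v := r.+1%:R ^+ (4 * K).+1 in rr *.
have u_gt0 : 0 < u by rewrite exprn_gt0.
have v_gt0 : 0 < v by rewrite exprn_gt0.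
set p2 := 2 ^+ (4 * K).+1 in rr *.
rewrite (_ : D * p2 / c / r%:R * (c / v) = D * (r%:R^-1 * (p2 / v)));
  last first.
  by field; rewrite !gt_eqF.
rewrite ler_wpM2l // ler_wpM2l ?invr_ge0 ?ler0n //.
by rewrite ler_pdivlMr // ler_pdivrMl // mulrC.
Qed.

End TreesOfSize.

(** * The range *)

Lemma bernoulli_ineq (R : realFieldType) (q : R) n :
  0 <= q -> 1 - n%:R * (1 - q) <= q ^+ n.
Proof.
move=> q0; elim: n => [|n IH]; first by rewrite mul0r subr0 expr0.
rewrite exprS; apply: le_trans (ler_wpM2l q0 IH).
rewrite -subr_ge0 -natr1 (_ : _ - _ = n%:R * (1 - q) ^+ 2); last by ring.
by rewrite mulr_ge0 ?ler0n ?sqr_ge0.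
Qed.

Section RangeBound.
Context {R : realType} (d : nat).
Context (mu : probability nat R) (theta : probability (lattice d) R).
Context disp (Omega : measurableType disp) (P : probability Omega R).
Context (T : {RV P >-> tree}) (W : Omega -> seq nat -> lattice d) (n : nat).
Hypothesis T_law : is_conditioned_bienayme mu n T.
Hypothesis W_walk : is_tree_walk theta T W.
Let w := tree_weight (pmass mu).
Let S := \sum_(t <- trees_of_size n) w t.

(** Outside of the event that the tree is of height at least [h] or that one
    of the [n] jumps leaves the box of size [J], the range lies in a box. *)
Lemma prob_range_gt_le (h J : nat) (a p b : R) : 0 < S ->
  \sum_(t <- trees_of_size n | (h <= height t)%N) w t <= p * S ->
  0 <= b -> 1 - b <= \sum_(x <- box d J) fine (theta [set x]) ->
  ((J * h + J * h).+1 ^ d)%N%:R <= a * n%:R -> (0 < n)%N ->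
  (P [set x | (a < (walk_range (T x) (W x))%:R / n%:R)%R] <=
     (p + n%:R * b)%:E)%E.
Proof.
move=> S_gt0 high b_ge0 box_ge size_le n_gt0.
have n0 : (0 : R) < n%:R by rewrite ltr0n.
pose s := [seq t <- trees_of_size n | (height t < h)%N].
have us : uniq s by rewrite filter_uniq // uniq_trees_of_size.
have ssz : {in s, forall t, size (vertices t) = n.+1}.
  by move=> t; rewrite mem_filter mem_trees_of_size => /andP[_ /eqP].
pose good := \bigcup_(t in [set` s]) jumps_in T W (box d J) t.
have mgood : measurable good.
  apply: fin_bigcup_measurable; first exact: finite_seq.
  by move=> t _; apply: (measurable_jumps_in W_walk).
set bad := [set x | _].
have bad_good : bad `<=` ~` good.
  move=> x /= xbad [t /= ts [Tx Hx]]; move: xbad; rewrite /bad /= Tx.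
  apply/negP; rewrite -leNgt ler_pdivrMr //; apply: le_trans size_le.
  rewrite ler_nat; apply: walk_range_le.
  - exact: (walk_root W_walk).
  - by move: ts; rewrite mem_filter => /andP[/ltnW].
  - by move=> v i vit; rewrite -mem_box; apply: Hx.
have mbad : measurable bad := measurable_range_gt W_walk a n.
have w_ge0 t : 0 <= w t by apply: (tree_weight_ge0 (pmass_ge0 mu)).
pose q := \sum_(x <- box d J) fine (theta [set x]).
pose low := \sum_(t <- s) w t.
have PT t : t \in s -> P (T @^-1` [set t]) = (w t / S)%:E.
  move=> ts; rewrite T_law /conditioned_law mem_set; last exact: ssz.
  by rewrite bienayme_sizeE.
have Pgood : P good = (low / S * q ^+ n)%:E.
  apply: etrans (prob_jumps_in_bigcup W_walk (uniq_box d J) us ssz) _.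
  rewrite EFinM; congr (_ * _)%E; rewrite /low mulr_suml -sumEFin.
  by rewrite big_seq [RHS]big_seq; apply: eq_bigr => t ts; exact: PT.
have lowE : low = S - \sum_(t <- trees_of_size n | (h <= height t)%N) w t.
  rewrite /low /s big_filter /S [X in _ = X - _](bigID (fun t =>
    (h <= height t)%N)) /=.
  by rewrite addrAC subrr add0r; apply: eq_bigl => t; rewrite ltnNge.
have low_ge0 : 0 <= low by apply: sumr_ge0.
have low_le : low <= S by rewrite lowE gerBl sumr_ge0.
have q_ge0 : 0 <= q by apply: sumr_ge0 => x _; apply: fine_ge0.
apply: (@le_trans _ _ (P (~` good))).
  by apply: le_measure => //; rewrite inE //; exact: measurableC.
rewrite probability_setC // Pgood -EFinB lee_fin.
set c := low / S.
have c_ge0 : 0 <= c by rewrite divr_ge0 // ltW.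
have c_le1 : c <= 1 by rewrite ler_pdivrMr // mul1r.
have c_low : 1 - p <= c.
  by rewrite ler_pdivlMr // mulrBl mul1r lowE lerD2l lerN2.
have qn : 1 - n%:R * b <= q ^+ n.
  apply: le_trans (bernoulli_ineq n q_ge0).
  by rewrite lerD2l lerN2 ler_wpM2l ?ler0n //; move: box_ge; rewrite -/q; lra.
have nb : 0 <= n%:R * b by rewrite mulr_ge0 ?ler0n.
have := ler_wpM2l c_ge0 qn.
have : c * (n%:R * b) <= n%:R * b by rewrite ler_piMl.
rewrite mulrBr mulr1; lra.
Qed.

End RangeBound.

Lemma nat_root K n : (0 < K)%N -> exists r, (r ^ K <= n < r.+1 ^ K)%N.
Proof.
move=> K_gt0.
have ex : exists r, (r ^ K <= n)%N by exists 0%N; rewrite exp0n.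
have bound r : (r ^ K <= n)%N -> (r <= n)%N.
  apply: leq_trans; case: r => // r.
  by rewrite -{1}(expn1 r.+1) leq_pexp2l.
case: (ex_maxnP ex bound) => r rn rmax; exists r; rewrite rn /= ltnNge.
by apply/negP => /rmax; rewrite ltnn.
Qed.

Theorem corollary1p5 (R : realType) (d : nat)
    (mu : probability nat R) (theta : probability (lattice d) R)
    (disp : nat -> measure_display)
    (Omega : forall n : nat, measurableType (disp n))
    (P : forall n : nat, probability (Omega n) R)
    (T : forall n : nat, {RV (P n) >-> tree})
    (W : forall n : nat, Omega n -> seq nat -> lattice d)
    (mu_critical : critical mu)
    (mu_rv : regularly_varying_seq (- 2) (pmass mu))
    (theta_centered : centered theta)
    (theta_cov : covariance_matrix theta \in unitmx)
    (theta_moments : finite_moments theta)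
    (T_law : forall n : nat, (0 < bienayme_size mu n)%E ->
       is_conditioned_bienayme mu n (T n))
    (W_walk : forall n : nat, (0 < bienayme_size mu n)%E ->
       is_tree_walk theta (T n) (W n))
    (eps : R) (eps_gt0 : 0 < eps) :
  P n [set w | eps < (walk_range (T n w) (W n w))%:R / n%:R]
    @[n --> within [set n | (0 < bienayme_size mu n)%E] \oo] --> 0%E.
Proof.
(* With height [r ^ 2] and jumps of size [r], the box has of the order of
   [r ^ (3 * d)] points, which must be negligible with respect to [r ^ K]. *)
pose K := (3 * d).+2.
have [M M_ge0 boxM] := box_mass_ge theta_moments (ltn0Sn K).
have [C [r0 high]] := high_trees_negligible mu_critical mu_rv (isT : (1 < K)%N).
apply: cvg_EFin.
  rewrite near_withinE; near=> n => size_gt0.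
  apply: fin_num_measure; apply: measurable_range_gt; exact: W_walk.
apply/cvgr0Pnorm_le => e e_gt0; rewrite near_withinE.
pose r1 := maxn (maxn 1 r0) (maxn (Num.truncn (3 ^+ d / eps)).+1
  (Num.truncn ((C + 2 ^+ K * M) / e)).+1).
exists (r1 ^ K)%N => // n /= r1n size_gt0.
have [r /andP[rn nr]] := @nat_root K n isT.
have r1r : (r1 <= r)%N.
  rewrite -ltnS -(ltn_exp2r _ _ (isT : 0 < K)%N); exact: leq_ltn_trans r1n nr.
move: r1r; rewrite !geq_max => /andP[/andP[r_gt0 r0r] /andP[r_eps r_e]].
have r0' : (0 : R) < r%:R by rewrite ltr0n.
have r_eps' : 3 ^+ d <= eps * r%:R.
  rewrite [leRHS]mulrC -ler_pdivrMr //.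
  by apply/ltW/(lt_le_trans (truncnS_gt _)); rewrite ler_nat.
have r_e' : C + 2 ^+ K * M <= e * r%:R.
  rewrite [leRHS]mulrC -ler_pdivrMr //.
  by apply/ltW/(lt_le_trans (truncnS_gt _)); rewrite ler_nat.
have rK : (0 : R) < r%:R ^+ K by rewrite exprn_gt0.
have n_gt0 : (0 < n)%N by apply: leq_trans rn; rewrite expn_gt0 r_gt0.
have [S_gt0 highS] := high n r r0r (introT andP (conj rn nr)).
have b_ge0 : 0 <= M / r%:R ^+ K.+1 by rewrite divr_ge0 // exprn_ge0 // ltW.
have size_le : ((r * r ^ 2 + r * r ^ 2).+1 ^ d)%N%:R <= eps * n%:R :> R.
  apply: (@le_trans _ _ ((3 * r ^ 3) ^ d)%N%:R).
    rewrite natrX [leRHS]natrX lerXn2r ?nnegrE ?ler0n // ler_nat -!expnS.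
    have r3 : (0 < r ^ 3)%N by rewrite expn_gt0 r_gt0.
    by lia.
  rewrite natrX natrM natrX exprMn -exprM.
  apply: (@le_trans _ _ (eps * r%:R * r%:R ^+ (3 * d))).
    by rewrite ler_wpM2r // exprn_ge0 // ltW.
  rewrite -mulrA ler_pM2l // -exprS -natrX ler_nat; apply: leq_trans rn.
  by rewrite leq_pexp2l.
have := prob_range_gt_le (T_law n size_gt0) (W_walk n size_gt0) S_gt0 highS
  b_ge0 (boxM r r_gt0) size_le n_gt0.
set p := P n _ => p_le.
have p_fin : p \is a fin_num.
  by apply: fin_num_measure; apply: measurable_range_gt; exact: W_walk.
rewrite /= ger0_norm ?fine_ge0 ?measure_ge0 //.
rewrite -lee_fin fineK //; apply: (le_trans p_le); rewrite lee_fin.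
apply: (@le_trans _ _ ((C + 2 ^+ K * M) / r%:R)); last by rewrite ler_pdivrMr.
have n_le : n%:R <= 2 ^+ K * r%:R ^+ K :> R.
  rewrite -exprMn -natrM -natrX ler_nat; apply: (leq_trans (ltnW nr)).
  by rewrite leq_exp2r // mul2n -addnn -addn1 leq_add2l.
rewrite mulrDl lerD2l mulrCA [2 ^+ K * M]mulrC -mulrA ler_wpM2l //.
by rewrite exprS invfM mulrCA mulrC ler_wpM2r ?invr_ge0 ?ler0n // ler_pdivrMr.
Unshelve. all: by end_near.
Qed.
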